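(* $\mathsf{RCA}_0+\mathsf{IPP}$ proves that the real numbers are uncountable, i.e., that for any family $(x_n)_{n\in\mathbb N}$ of reals there is a $y\in\mathbb R$ with $x_n\neq y$ for all $n\in\mathbb N$.
   Context: $\mathsf{RCA}_0$ is the usual base system of second-order arithmetic (basic arithmetic axioms, $\Sigma^0_1$-induction, $\Delta^0_1$-comprehension). Reals. A real is a Cauchy sequence $x=(x_n)_{n\in\mathbb N}$ of rationals with no rate of convergence given: for each rational $\varepsilon>0$ there is an $N\in\mathbb N$ with $|x_m-x_n|<\varepsilon$ for all $m,n\geq N$. For reals $x,y$: $x\leq y$ means that for each rational $\varepsilon>0$ there is an $N$ with $x_n\leq y_n+\varepsilon$ for all $n\geq N$; $x=y$ means $x\leq y$ and $y\leq x$; $x\neq y$ is its negation. A family $(x_n)_{n\in\mathbb N}$ of reals is a double sequence $(x_{ni})_{n,i\in\mathbb N}$ of rationals with the only requirement that $x_n=(x_{ni})_{i\in\mathbb N}$ is Cauchy for each $n\in\mathbb N$ (no uniformity in $n$). $\mathsf{IPP}$ (infinite pigeonhole principle): for any $N\in\mathbb N$ and any $c\colon\mathbb N\to\{0,\ldots,N\}$ there is an $n\leq N$ such that $\{i\in\mathbb N:c(i)=n\}$ is infinite. *)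

(* Defs.v *)
From Stdlib Require Import List Arith.
Import ListNotations.

(* * The language of second-order arithmetic

   Two-sorted syntax with de Bruijn indices.  Numerical variables and set
   variables have separate index spaces: [AllN] binds numerical index 0 and
   leaves set indices alone, [AllS] conversely.  The only set terms are
   variables, and equality is primitive for numbers only. *)

Inductive term : Type :=
| Var (i : nat)
| Zero
| One
| Add (s t : term)
| Mul (s t : term).

Coercion Var : nat >-> term.

Inductive formula : Type :=
| Bot
| Equal (s t : term)
| Less (s t : term)
| Mem (t : term) (X : nat)
| Imp (p q : formula)
| AllN (p : formula)
| AllS (p : formula).

(* The logic is classical, so the other connectives are abbreviations. *)
Definition Neg (p : formula) : formula := Imp p Bot.
Definition And (p q : formula) : formula := Neg (Imp p (Neg q)).
Definition Or (p q : formula) : formula := Imp (Neg p) q.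
Definition Iff (p q : formula) : formula := And (Imp p q) (Imp q p).
Definition ExN (p : formula) : formula := Neg (AllN (Neg p)).
Definition ExS (p : formula) : formula := Neg (AllS (Neg p)).
Definition LessEq (s t : term) : formula := Or (Less s t) (Equal s t).

Declare Scope so_scope.
Delimit Scope so_scope with so.
Bind Scope so_scope with term formula.
Open Scope so_scope.
Infix "⊕" := Add (at level 50, left associativity) : so_scope.
Infix "⊗" := Mul (at level 40, left associativity) : so_scope.
Infix "≐" := Equal (at level 70, no associativity) : so_scope.
Infix "≺" := Less (at level 70, no associativity) : so_scope.
Infix "≼" := LessEq (at level 70, no associativity) : so_scope.
Infix "∈" := Mem (at level 70, no associativity) : so_scope.
Notation "¬ p" := (Neg p) (at level 75, right associativity) : so_scope.
Infix "∧" := And (at level 80, right associativity) : so_scope.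
Infix "∨" := Or (at level 85, right associativity) : so_scope.
Infix "⇔" := Iff (at level 95, no associativity) : so_scope.
Infix "⇒" := Imp (at level 90, right associativity) : so_scope.

Fixpoint subst_term (f : nat -> term) (t : term) : term :=
  match t with
  | Var i => f i
  | Zero => Zero
  | One => One
  | Add s u => Add (subst_term f s) (subst_term f u)
  | Mul s u => Mul (subst_term f s) (subst_term f u)
  end.

Definition shift_term (t : term) : term := subst_term (fun i => Var (S i)) t.

Definition upN (f : nat -> term) (i : nat) : term :=
  match i with 0 => Var 0 | S k => shift_term (f k) end.

Definition upS (g : nat -> nat) (i : nat) : nat :=
  match i with 0 => 0 | S k => S (g k) end.

Fixpoint subst (f : nat -> term) (g : nat -> nat) (p : formula) : formula :=
  match p with
  | Bot => Bot
  | Equal s t => Equal (subst_term f s) (subst_term f t)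
  | Less s t => Less (subst_term f s) (subst_term f t)
  | Mem t X => Mem (subst_term f t) (g X)
  | Imp q r => Imp (subst f g q) (subst f g r)
  | AllN q => AllN (subst (upN f) g q)
  | AllS q => AllS (subst f (upS g) q)
  end.

Definition substN (f : nat -> term) (p : formula) : formula :=
  subst f (fun X => X) p.
Definition substS (g : nat -> nat) (p : formula) : formula := subst Var g p.

Definition shiftN : formula -> formula := substN (fun i => Var (S i)).
Definition shiftS : formula -> formula := substS S.

Definition instN (t : term) : formula -> formula :=
  substN (fun i => match i with 0 => t | S k => Var k end).
Definition instS (X : nat) : formula -> formula :=
  substS (fun i => match i with 0 => X | S k => k end).

(* * Provability

   Classical natural deduction with equality.  Members of the theory [T] may
   be used in any context, also below [prv_allNI] and [prv_allSI]: a free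
   variable of an axiom thus counts as universally quantified. *)

Inductive prv (T : formula -> Prop) : list formula -> formula -> Prop :=
| prv_ax G p : T p -> prv T G p
| prv_hyp G p : In p G -> prv T G p
| prv_impI G p q : prv T (p :: G) q -> prv T G (p ⇒ q)
| prv_impE G p q : prv T G (p ⇒ q) -> prv T G p -> prv T G q
| prv_raa G p : prv T ((¬ p) :: G) Bot -> prv T G p
| prv_allNI G p : prv T (map shiftN G) p -> prv T G (AllN p)
| prv_allNE G p t : prv T G (AllN p) -> prv T G (instN t p)
| prv_allSI G p : prv T (map shiftS G) p -> prv T G (AllS p)
| prv_allSE G p X : prv T G (AllS p) -> prv T G (instS X p)
| prv_refl G t : prv T G (t ≐ t)
| prv_rewrite G s t p :
    prv T G (s ≐ t) -> prv T G (instN s p) -> prv T G (instN t p).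

Definition proves (T : formula -> Prop) (p : formula) : Prop := prv T [] p.

(* * The theory RCA_0 *)

Inductive basic_axiom : formula -> Prop :=
| ax_succ_neq0 : basic_axiom (¬ (0 ⊕ One ≐ Zero))
| ax_succ_inj : basic_axiom (0 ⊕ One ≐ 1 ⊕ One ⇒ 0 ≐ 1)
| ax_add0 : basic_axiom (0 ⊕ Zero ≐ 0)
| ax_addS : basic_axiom (0 ⊕ (1 ⊕ One) ≐ (0 ⊕ 1) ⊕ One)
| ax_mul0 : basic_axiom (0 ⊗ Zero ≐ Zero)
| ax_mulS : basic_axiom (0 ⊗ (1 ⊕ One) ≐ 0 ⊗ 1 ⊕ 0)
| ax_lt0 : basic_axiom (¬ (0 ≺ Zero))
| ax_ltS : basic_axiom (0 ≺ 1 ⊕ One ⇔ (0 ≺ 1 ∨ 0 ≐ 1)).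

(* Bounded existential quantification is [¬ ∀ x < t, ¬ p]. *)
Inductive bounded : formula -> Prop :=
| bounded_bot : bounded Bot
| bounded_eq s t : bounded (s ≐ t)
| bounded_lt s t : bounded (s ≺ t)
| bounded_mem t X : bounded (t ∈ X)
| bounded_imp p q : bounded p -> bounded q -> bounded (p ⇒ q)
| bounded_all t p : bounded p -> bounded (AllN (0 ≺ shift_term t ⇒ p)).

Definition Sigma01 (p : formula) : Prop :=
  exists q, bounded q /\ p = ExN q.
Definition Pi01 (p : formula) : Prop :=
  exists q, bounded q /\ p = AllN q.

(* The distinguished variable of [p] (and [q]) is numerical index 0; all other
   free variables are parameters. *)
Definition induction (p : formula) : formula :=
  instN Zero p ∧
  AllN (p ⇒ substN (fun i => match i with 0 => 0 ⊕ One | S k => S k end) p) ⇒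
  AllN p.

Definition comprehension (p q : formula) : formula :=
  AllN (p ⇔ q) ⇒ ExS (AllN (0 ∈ 0 ⇔ shiftS p)).

Inductive RCA0 : formula -> Prop :=
| RCA0_basic p : basic_axiom p -> RCA0 p
| RCA0_induction p : Sigma01 p -> RCA0 (induction p)
| RCA0_comprehension p q : Sigma01 p -> Pi01 q -> RCA0 (comprehension p q).

(* * Quantification over named variables

   From here on free indices serve as names: [forallN [x; y] p] quantifies the
   free variables [Var x] and [Var y] of [p], and every other free variable
   keeps its name.  Capture is possible, so the names bound in a definition
   must not occur in its arguments. *)

Definition abstract (x i : nat) : nat := if i =? x then 0 else S i.

Definition forallN (xs : list nat) (p : formula) : formula :=
  fold_right (fun x q => AllN (substN (fun i => Var (abstract x i)) q)) p xs.
Definition existsN (xs : list nat) (p : formula) : formula :=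
  fold_right (fun x q => ExN (substN (fun i => Var (abstract x i)) q)) p xs.
Definition forallS (X : nat) (p : formula) : formula :=
  AllS (substS (abstract X) p).
Definition existsS (X : nat) (p : formula) : formula :=
  ExS (substS (abstract X) p).

Definition vN := 0.
Definition vn := 1.
Definition vm := 2.
Definition vi := 3.
Definition vk := 4.
Definition vp := 5.
Definition vu := 6.
Definition vw := 7.

Definition sC := 0.
Definition sX := 0.
Definition sY := 1.

(* The injective (not surjective) pairing [(s + t)^2 + s]. *)
Definition npair (s t : term) : term := (s ⊕ t) ⊗ (s ⊕ t) ⊕ s.

(* [X], as a set of pairs, has exactly one value at argument [t]. *)
Definition has_unique_value (X : nat) (t : term) : formula :=
  existsN [vu] (npair t vu ∈ X ∧ forallN [vw] (npair t vw ∈ X ⇒ vw ≐ vu)).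

(* * The infinite pigeonhole principle *)

(* [C] is a function from the natural numbers to {0, ..., [b]}. *)
Definition is_colouring (C : nat) (b : term) : formula :=
  forallN [vp] (vp ∈ C ⇒ existsN [vi; vn] (vn ≼ b ∧ vp ≐ npair vi vn)) ∧
  forallN [vi] (has_unique_value C vi).

Definition IPP : formula :=
  forallN [vN] (forallS sC (is_colouring sC vN ⇒
    existsN [vn] (vn ≼ vN ∧
      forallN [vk] (existsN [vi] (vk ≼ vi ∧ npair vi vn ∈ sC))))).

(* * Rationals *)

(* The rational (pos - neg) / den, for a term [den] with positive values. *)
Record fraction : Type := Fraction { pos : term; neg : term; den : term }.

Definition qzero : fraction := Fraction Zero Zero One.
Definition qadd (x y : fraction) : fraction :=
  Fraction (pos x ⊗ den y ⊕ pos y ⊗ den x)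
           (neg x ⊗ den y ⊕ neg y ⊗ den x)
           (den x ⊗ den y).
Definition qlt (x y : fraction) : formula :=
  pos x ⊗ den y ⊕ neg y ⊗ den x ≺ pos y ⊗ den x ⊕ neg x ⊗ den y.
Definition qle (x y : fraction) : formula :=
  pos x ⊗ den y ⊕ neg y ⊗ den x ≼ pos y ⊗ den x ⊕ neg x ⊗ den y.
(* |x - y| < e *)
Definition qclose (x y e : fraction) : formula :=
  qlt x (qadd y e) ∧ qlt y (qadd x e).

(* A rational variable is a triple of numerical variables (a, b, c), standing
   for (a - b) / (c + 1) and coded by the number ((a, b), c).  A rational has
   many codes; codes are only compared through the order of the rationals. *)
Record qvar : Type := QVar { qa : nat; qb : nat; qc : nat }.

Definition value (q : qvar) : fraction :=
  Fraction (qa q) (qb q) (qc q ⊕ One).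
Coercion value : qvar >-> fraction.
Definition code (q : qvar) : term := npair (npair (qa q) (qb q)) (qc q).

Definition forallQ (q : qvar) (p : formula) : formula :=
  forallN [qa q; qb q; qc q] p.
Definition existsQ (q : qvar) (p : formula) : formula :=
  existsN [qa q; qb q; qc q] p.

Definition eps : qvar := QVar 10 11 12.
Definition vq : qvar := QVar 20 21 22.
Definition vr : qvar := QVar 30 31 32.

(* * Reals *)

(* [X] is a sequence of rationals: a function from numbers to codes. *)
Definition is_sequence (X : nat) : formula :=
  forallN [vp] (vp ∈ X ⇒ existsN [vi] (existsQ vq (vp ≐ npair vi (code vq)))) ∧
  forallN [vi] (has_unique_value X vi).

(* [X] is a double sequence of rationals: a function from pairs to codes. *)
Definition is_double_sequence (X : nat) : formula :=
  forallN [vp] (vp ∈ X ⇒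
    existsN [vn; vi] (existsQ vq (vp ≐ npair (npair vn vi) (code vq)))) ∧
  forallN [vn; vi] (has_unique_value X (npair vn vi)).

(* Either the sequence [X] itself, or the row i |-> X(n, i) of a double
   sequence [X]. *)
Inductive sequence : Type :=
| Whole (X : nat)
| Row (X : nat) (n : term).

(* The term of [x] at index [i] is the rational coded by [q]. *)
Definition entry (x : sequence) (i : term) (q : qvar) : formula :=
  match x with
  | Whole X => npair i (code q) ∈ X
  | Row X n => npair (npair n i) (code q) ∈ X
  end.

Definition cauchy (x : sequence) : formula :=
  forallQ eps (qlt qzero eps ⇒ existsN [vN] (forallN [vm; vk] (
    vN ≼ vm ∧ vN ≼ vk ⇒
    forallQ vq (forallQ vr (entry x vm vq ∧ entry x vk vr ⇒ qclose vq vr eps))))).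

Definition real_le (x y : sequence) : formula :=
  forallQ eps (qlt qzero eps ⇒ existsN [vN] (forallN [vk] (
    vN ≼ vk ⇒
    forallQ vq (forallQ vr (entry x vk vq ∧ entry y vk vr ⇒
      qle vq (qadd vr eps)))))).

Definition real_eq (x y : sequence) : formula := real_le x y ∧ real_le y x.

Definition is_real (X : nat) : formula := is_sequence X ∧ cauchy (Whole X).

Definition is_family (X : nat) : formula :=
  is_double_sequence X ∧ forallN [vn] (cauchy (Row X vn)).

Definition reals_uncountable : formula :=
  forallS sX (is_family sX ⇒
    existsS sY (is_real sY ∧ forallN [vn] (¬ real_eq (Row sX vn) (Whole sY)))).

(* Main.v *)
(** By Henkin completeness for the two-sorted calculus it suffices to argue in an
    arbitrary structure [M] that satisfies RCA_0 and IPP.  The numbers of [M]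
    form a discretely ordered semiring, and rationals are evaluated in its
    ordered field of fractions.

    Given a family [x_n], the digits of [y] in base 4 are chosen against the
    [x_n] as in Cantor's proof.  The [n]-th digit has to be guessed at each
    stage [i]: it avoids the value of [x_n] at the least index [j] from which
    [x_n] stays within [4^-(n+1) / 2] of [x_nj] up to stage [i].  This index can
    only increase and is bounded, so the guess stabilises even if [x_n]
    oscillates around the boundary between two digits.  Let [y_i] be the number
    whose first [i] digits are those guessed at stage [i].  IPP yields a common
    stage at which the guesses for the first [m] digits are final: otherwise
    colour the stage [N] with some [n < m] whose digit still changes after [N];
    a colour that is used infinitely often contradicts the stability of that
    digit.  So [y] is Cauchy, and it keeps a distance of [4^-(n+1) / 2] from
    [x_n]. *)

From Stdlib Require List.
From HB Require Import structures.
From mathcomp Require Import all_boot all_order all_algebra.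
From mathcomp Require Import boolp ring lra zify.
Require Import Defs.

Set Implicit Arguments.
Unset Strict Implicit.
Unset Printing Implicit Defensive.

Arguments prv_impI {T G p q}.
Arguments prv_impE {T G p q}.

(** * Substitution *)

(** Two restrictions of the base theory shape the argument. The limits of the digit guesses are not
    computable from the family in general, so the digit sequence of the limit need not be a set of
    the model. Only the rational approximations $y_i$ are computable, which is enough because a real
    carries no rate of convergence. Further, [M] may be nonstandard and satisfies induction for Σ1
    formulas only. Every statement proved by induction must therefore be brought into Σ1 or Δ1 form,
    which is why inequalities of rationals are cleared of denominators and many witnesses carry
    explicit bounds. Powers of 4 and the numbers formed from the digits are not given by the
    language either; they require primitive recursion, obtained from Gödel's coding of finite sets
    inside [M]. The stability of a single digit follows from Σ1 induction. IPP enters once, to make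
    finitely many digits stable at the same time when finitely many is understood in the sense of
    [M]. *)

Definition scons {A : Type} (a : A) (f : nat -> A) (i : nat) : A :=
  if i is k.+1 then f k else a.

Lemma subst_term_ext (f f' : nat -> term) t :
  f =1 f' -> subst_term f t = subst_term f' t.
Proof. by move=> E; elim: t => //= [s -> u ->|s -> u ->]. Qed.

Lemma subst_term_comp (f f' : nat -> term) t :
  subst_term f (subst_term f' t) = subst_term (fun i => subst_term f (f' i)) t.
Proof. by elim: t => //= [s -> u ->|s -> u ->]. Qed.

Lemma subst_term_id t : subst_term Var t = t.
Proof. by elim: t => //= [s -> u ->|s -> u ->]. Qed.

Lemma subst_term_shift (f : nat -> term) t :
  subst_term f (shift_term t) = subst_term (fun i => f i.+1) t.
Proof. by rewrite /shift_term subst_term_comp. Qed.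

Lemma upN_shift (f : nat -> term) t :
  subst_term (upN f) (shift_term t) = shift_term (subst_term f t).
Proof. by rewrite /shift_term !subst_term_comp; apply: subst_term_ext. Qed.

Lemma subst_ext p (f f' : nat -> term) (g g' : nat -> nat) :
  f =1 f' -> g =1 g' -> subst f g p = subst f' g' p.
Proof.
elim: p f f' g g' => //=.
- by move=> s t f f' g g' Ef _; rewrite !(subst_term_ext _ Ef).
- by move=> s t f f' g g' Ef _; rewrite !(subst_term_ext _ Ef).
- by move=> t X f f' g g' Ef Eg; rewrite (subst_term_ext _ Ef) Eg.
- by move=> p IHp q IHq f f' g g' Ef Eg; rewrite (IHp _ _ _ _ Ef Eg) (IHq _ _ _ _ Ef Eg).
- by move=> p IH f f' g g' Ef Eg; rewrite (IH _ (upN f') _ g') // => -[|i] //=; rewrite Ef.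
- by move=> p IH f f' g g' Ef Eg; rewrite (IH _ f' _ (upS g')) // => -[|i] //=; rewrite Eg.
Qed.

Lemma subst_comp p (f f' : nat -> term) (g g' : nat -> nat) :
  subst f g (subst f' g' p) = subst (fun i => subst_term f (f' i)) (g \o g') p.
Proof.
elim: p f f' g g' => //=.
- by move=> s t f f' g g'; rewrite !subst_term_comp.
- by move=> s t f f' g g'; rewrite !subst_term_comp.
- by move=> t X f f' g g'; rewrite subst_term_comp.
- by move=> p IHp q IHq f f' g g'; rewrite IHp IHq.
- move=> p IH f f' g g'; rewrite IH; congr AllN.
  by apply: subst_ext => // -[|i] //=; rewrite upN_shift.
- move=> p IH f f' g g'; rewrite IH; congr AllS.
  by apply: subst_ext => // -[|i].
Qed.

Lemma subst_id p : subst Var id p = p.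
Proof.
elim: p => //=.
- by move=> s t; rewrite !subst_term_id.
- by move=> s t; rewrite !subst_term_id.
- by move=> t X; rewrite subst_term_id.
- by move=> p -> q ->.
- by move=> p {2}<-; congr AllN; apply: subst_ext => // -[].
- by move=> p {2}<-; congr AllS; apply: subst_ext => // -[].
Qed.

Fixpoint boundN_term (t : term) : nat :=
  match t with
  | Var i => i.+1
  | Zero | One => 0
  | Add s u | Mul s u => maxn (boundN_term s) (boundN_term u)
  end.

Fixpoint boundN (p : formula) : nat :=
  match p with
  | Bot => 0
  | Equal s t | Less s t => maxn (boundN_term s) (boundN_term t)
  | Mem t _ => boundN_term t
  | Imp q r => maxn (boundN q) (boundN r)
  | AllN q => (boundN q).-1
  | AllS q => boundN q
  end.

Fixpoint boundS (p : formula) : nat :=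
  match p with
  | Bot | Equal _ _ | Less _ _ => 0
  | Mem _ X => X.+1
  | Imp q r => maxn (boundS q) (boundS r)
  | AllN q => boundS q
  | AllS q => (boundS q).-1
  end.

Lemma subst_term_bound (f f' : nat -> term) t :
  (forall i, i < boundN_term t -> f i = f' i) -> subst_term f t = subst_term f' t.
Proof.
elim: t => //= [i|s IHs u IHu|s IHs u IHu] E; first exact: E.
- by rewrite IHs ?IHu // => i Hi; apply: E; lia.
- by rewrite IHs ?IHu // => i Hi; apply: E; lia.
Qed.

Lemma subst_bound p (f f' : nat -> term) (g g' : nat -> nat) :
  (forall i, i < boundN p -> f i = f' i) ->
  (forall X, X < boundS p -> g X = g' X) ->
  subst f g p = subst f' g' p.
Proof.
elim: p f f' g g' => //=.
- by move=> s t f f' g g' Ef _; congr Equal; apply: subst_term_bound => i Hi; apply: Ef; lia.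
- by move=> s t f f' g g' Ef _; congr Less; apply: subst_term_bound => i Hi; apply: Ef; lia.
- by move=> t X f f' g g' Ef Eg; rewrite (subst_term_bound Ef) Eg.
- move=> p IHp q IHq f f' g g' Ef Eg; congr Imp.
  + by apply: IHp => i Hi; [apply: Ef|apply: Eg]; lia.
  + by apply: IHq => i Hi; [apply: Ef|apply: Eg]; lia.
- move=> p IH f f' g g' Ef Eg; congr AllN; apply: IH => // -[|i] //= Hi.
  by rewrite Ef //; lia.
- move=> p IH f f' g g' Ef Eg; congr AllS; apply: IH => // -[|i] //= Hi.
  by rewrite Eg //; lia.
Qed.

(** * Structural rules *)

Section Calculus.
Variable T : formula -> Prop.

Lemma prv_weaken G p : prv T G p -> forall G', List.incl G G' -> prv T G' p.
Proof.
elim=> {G p}.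
- by move=> G p Tp G' _; apply: prv_ax.
- by move=> G p Gp G' sub; apply: prv_hyp; apply: sub.
- move=> G p q _ IH G' sub; apply: prv_impI; apply: IH.
  by move=> r [->|Gr]; [left|right; apply: sub].
- by move=> G p q _ IH1 _ IH2 G' sub; apply: prv_impE (IH1 _ sub) (IH2 _ sub).
- move=> G p _ IH G' sub; apply: prv_raa; apply: IH.
  by move=> r [->|Gr]; [left|right; apply: sub].
- by move=> G p _ IH G' sub; apply: prv_allNI; apply: IH; apply: List.incl_map.
- by move=> G p t _ IH G' sub; apply: prv_allNE; apply: IH.
- by move=> G p _ IH G' sub; apply: prv_allSI; apply: IH; apply: List.incl_map.
- by move=> G p X _ IH G' sub; apply: prv_allSE; apply: IH.
- by move=> *; apply: prv_refl.
- by move=> G s t p _ IH1 _ IH2 G' sub; apply: prv_rewrite (IH1 _ sub) (IH2 _ sub).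
Qed.

Lemma prv_weaken1 G p q : prv T G p -> prv T (q :: G) p.
Proof. by move/prv_weaken; apply=> r; right. Qed.

Lemma prv_weaken0 G p : prv T [::] p -> prv T G p.
Proof. by move/prv_weaken; apply. Qed.

Lemma prv_assum G p : prv T (p :: G) p.
Proof. by apply: prv_hyp; left. Qed.

Lemma prv_botE G p : prv T G Bot -> prv T G p.
Proof. by move=> H; apply: prv_raa; apply: prv_weaken1. Qed.

(* The variables below [k] are generalised one at a time and instantiated in
   the reverse order. *)
Lemma prv_substN_below k p (f : nat -> term) :
  prv T [::] p ->
  prv T [::] (substN (fun i => if i < k then f i else Var (i - k)) p).
Proof.
elim: k p f => [|k IH] p f Hp.
  suff -> : substN (fun i => if i < 0 then f i else Var (i - 0)) p = p by [].
  by rewrite -{2}[p]subst_id; apply: subst_ext => // i; rewrite /= subn0.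
have /(@prv_allNE _ _ _ (f 0)) := IH _ (fun i => f i.+1) (@prv_allNI T [::] p Hp).
rewrite /instN /substN subst_comp.
set q := subst _ _ _; set r := subst _ _ _.
suff -> : q = r by [].
apply: subst_ext => // -[|i] //=.
rewrite subst_term_shift ltnS subSS.
by case: ifP => // _; exact: subst_term_id.
Qed.

(** A formula has finitely many free variables, so replacing those below [boundN p] is already the
    full substitution. *)
Lemma prv_substN p (f : nat -> term) : prv T [::] p -> prv T [::] (substN f p).
Proof.
move=> /(prv_substN_below (boundN p) f).
suff -> : substN (fun i => if i < boundN p then f i else Var (i - boundN p)) p =
          substN f p by [].
by apply: subst_bound => // i ->.
Qed.

Lemma prv_substS_below k p (g : nat -> nat) :
  prv T [::] p ->
  prv T [::] (substS (fun i => if i < k then g i else i - k) p).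
Proof.
elim: k p g => [|k IH] p g Hp.
  suff -> : substS (fun i => if i < 0 then g i else i - 0) p = p by [].
  by rewrite -{2}[p]subst_id; apply: subst_ext => // i; rewrite /= subn0.
have /(@prv_allSE _ _ _ (g 0)) := IH _ (fun i => g i.+1) (@prv_allSI T [::] p Hp).
rewrite /instS /substS subst_comp.
set q := subst _ _ _; set r := subst _ _ _.
suff -> : q = r by [].
by apply: subst_ext => // -[|i].
Qed.

Lemma prv_substS p (g : nat -> nat) : prv T [::] p -> prv T [::] (substS g p).
Proof.
move=> /(prv_substS_below (boundS p) g).
suff -> : substS (fun i => if i < boundS p then g i else i - boundS p) p =
          substS g p by [].
by apply: subst_bound => // i ->.
Qed.

Lemma prv_subst0 p f g : prv T [::] p -> prv T [::] (subst f g p).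
Proof.
move=> /(prv_substS g) /(prv_substN f).
by rewrite /substN /substS subst_comp.
Qed.

(** Moving the context into the formula reduces substitution in arbitrary contexts to the case of
    the empty context, where generalisation is unrestricted. *)
Definition imps (G : list formula) (p : formula) : formula :=
  List.fold_left (fun q r => Imp r q) G p.

Lemma prv_imps G p : prv T G p <-> prv T [::] (imps G p).
Proof.
elim: G p => //= q G IH p; rewrite -IH; split; first exact: prv_impI.
by move=> H; apply: prv_impE (prv_assum _ _); apply: prv_weaken1.
Qed.

Lemma subst_imps f g G p :
  subst f g (imps G p) = imps (List.map (subst f g) G) (subst f g p).
Proof. by elim: G p => //= q G IH p; rewrite IH. Qed.

Lemma prv_subst G p f g :
  prv T G p -> prv T (List.map (subst f g) G) (subst f g p).
Proof. by rewrite prv_imps => /(prv_subst0 f g); rewrite subst_imps -prv_imps. Qed.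

Definition freshN (x : nat) (G : list formula) : Prop :=
  forall p, List.In p G -> boundN p <= x.
Definition freshS (x : nat) (G : list formula) : Prop :=
  forall p, List.In p G -> boundS p <= x.

Lemma fresh_exists G : exists x, freshN x G /\ freshS x G.
Proof.
elim: G => [|q G [x [xN xS]]]; first by exists 0; split.
exists (maxn x (maxn (boundN q) (boundS q))).
by split=> p /= [<-|H]; [|have := xN _ H| |have := xS _ H]; lia.
Qed.

(** The eigenvariable rule with a named variable. The substitution that sends [x] to index 0 and
    shifts the rest undoes the instantiation of [p], and on [G], where [x] does not occur, it is the
    shift required by [prv_allNI]. *)
Lemma prv_allN_fresh x G p :
  freshN x G -> boundN (AllN p) <= x -> prv T G (instN (Var x) p) ->
  prv T G (AllN p).
Proof.
move=> xG /= xp.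
move/(prv_subst (fun i => if i == x then Var 0 else Var i.+1) id) => H.
apply: prv_allNI.
have -> : List.map shiftN G =
    List.map (subst (fun i => if i == x then Var 0 else Var i.+1) id) G.
  apply: List.map_ext_in => q /xG xq; apply: subst_bound => // i Hi.
  by case: eqP => //; lia.
suff -> : p = subst (fun i => if i == x then Var 0 else Var i.+1) id (instN (Var x) p) by [].
rewrite /instN /substN subst_comp -{1}[p]subst_id; apply: subst_bound => // -[|i] Hi /=.
  by rewrite eqxx.
by case: eqP => //; lia.
Qed.

Lemma prv_allS_fresh x G p :
  freshS x G -> boundS (AllS p) <= x -> prv T G (instS x p) ->
  prv T G (AllS p).
Proof.
move=> xG /= xp.
move/(prv_subst Var (fun i => if i == x then 0 else i.+1)) => H.
apply: prv_allSI.
have -> : List.map shiftS G =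
    List.map (subst Var (fun i => if i == x then 0 else i.+1)) G.
  apply: List.map_ext_in => q /xG xq; apply: subst_bound => // i Hi.
  by case: eqP => //; lia.
suff -> : p = subst Var (fun i => if i == x then 0 else i.+1) (instS x p) by [].
rewrite /instS /substS subst_comp -{1}[p]subst_id; apply: subst_bound => // -[|i] Hi /=.
  by rewrite eqxx.
by case: eqP => //; lia.
Qed.

(** Each equality law below is an instance of [prv_rewrite]: index 0 marks the place to be
    rewritten, and all other terms are shifted to keep them away from it. *)
Lemma prv_eq_sym G s t : prv T G (Equal s t) -> prv T G (Equal t s).
Proof.
move=> Hst; have := @prv_rewrite T G s t (Equal (Var 0) (shift_term s)) Hst.
rewrite /instN /substN /= !subst_term_shift !subst_term_id.
by apply; apply: prv_refl.
Qed.

Lemma prv_eq_trans G s t u :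
  prv T G (Equal s t) -> prv T G (Equal t u) -> prv T G (Equal s u).
Proof.
move=> Hst Htu; have := @prv_rewrite T G t u (Equal (shift_term s) (Var 0)) Htu.
by rewrite /instN /substN /= !subst_term_shift !subst_term_id; apply.
Qed.

Lemma prv_eq_add G s s' t t' :
  prv T G (Equal s s') -> prv T G (Equal t t') ->
  prv T G (Equal (Add s t) (Add s' t')).
Proof.
move=> Hs Ht; apply: (@prv_eq_trans _ _ (Add s' t)).
  have := @prv_rewrite T G s s' (Equal (Add (shift_term s) (shift_term t))
                                     (Add (Var 0) (shift_term t))) Hs.
  rewrite /instN /substN /= !subst_term_shift !subst_term_id; apply.
  exact: prv_refl.
have := @prv_rewrite T G t t' (Equal (Add (shift_term s') (shift_term t))
                                     (Add (shift_term s') (Var 0))) Ht.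
rewrite /instN /substN /= !subst_term_shift !subst_term_id; apply.
exact: prv_refl.
Qed.

Lemma prv_eq_mul G s s' t t' :
  prv T G (Equal s s') -> prv T G (Equal t t') ->
  prv T G (Equal (Mul s t) (Mul s' t')).
Proof.
move=> Hs Ht; apply: (@prv_eq_trans _ _ (Mul s' t)).
  have := @prv_rewrite T G s s' (Equal (Mul (shift_term s) (shift_term t))
                                     (Mul (Var 0) (shift_term t))) Hs.
  rewrite /instN /substN /= !subst_term_shift !subst_term_id; apply.
  exact: prv_refl.
have := @prv_rewrite T G t t' (Equal (Mul (shift_term s') (shift_term t))
                                     (Mul (shift_term s') (Var 0))) Ht.
rewrite /instN /substN /= !subst_term_shift !subst_term_id; apply.
exact: prv_refl.
Qed.

Lemma prv_eq_less G s s' t t' :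
  prv T G (Equal s s') -> prv T G (Equal t t') ->
  prv T G (Less s t) -> prv T G (Less s' t').
Proof.
move=> Hs Ht Hst.
have := @prv_rewrite T G t t' (Less (shift_term s') (Var 0)) Ht.
rewrite /instN /substN /= !subst_term_shift !subst_term_id; apply.
have := @prv_rewrite T G s s' (Less (Var 0) (shift_term t)) Hs.
by rewrite /instN /substN /= !subst_term_shift !subst_term_id; apply.
Qed.

Lemma prv_eq_mem G s s' X :
  prv T G (Equal s s') -> prv T G (Mem s X) -> prv T G (Mem s' X).
Proof.
by move=> Hs; have := @prv_rewrite T G s s' (Mem (Var 0) X) Hs; apply.
Qed.

End Calculus.

(** * Structures *)

(** The second sort is any type with a membership relation, so sets need not be extensional. This
    lets the term model take the set variables themselves as its sets. *)
Record structure : Type := Structure {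
  dom :> Type;
  sets : Type;
  s0 : dom;
  s1 : dom;
  sadd : dom -> dom -> dom;
  smul : dom -> dom -> dom;
  slt : dom -> dom -> Prop;
  smem : dom -> sets -> Prop }.

Fixpoint eval (M : structure) (rho : nat -> M) (t : term) : M :=
  match t with
  | Var i => rho i
  | Zero => s0 M
  | One => s1 M
  | Add s u => sadd (eval rho s) (eval rho u)
  | Mul s u => smul (eval rho s) (eval rho u)
  end.

Fixpoint sat (M : structure) (rho : nat -> M) (sigma : nat -> sets M)
    (p : formula) : Prop :=
  match p with
  | Bot => False
  | Equal s t => eval rho s = eval rho t
  | Less s t => slt (eval rho s) (eval rho t)
  | Mem t X => smem (eval rho t) (sigma X)
  | Imp q r => sat rho sigma q -> sat rho sigma r
  | AllN q => forall d, sat (scons d rho) sigma q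
  | AllS q => forall D, sat rho (scons D sigma) q
  end.

Definition models (M : structure) (T : formula -> Prop) : Prop :=
  forall p, T p -> forall rho sigma, @sat M rho sigma p.

Section Satisfaction.
Variable M : structure.
Implicit Types (rho : nat -> M) (sigma : nat -> sets M).

Lemma eval_ext rho rho' t : rho =1 rho' -> eval rho t = eval rho' t.
Proof. by move=> E; elim: t => //= [s -> u ->|s -> u ->]. Qed.

Lemma sat_ext p rho rho' sigma sigma' : rho =1 rho' -> sigma =1 sigma' ->
  sat rho sigma p <-> sat rho' sigma' p.
Proof. by move=> /funext -> /funext ->. Qed.

Lemma eval_subst rho f t :
  eval rho (subst_term f t) = eval (fun i => eval rho (f i)) t.
Proof. by elim: t => //= [s -> u ->|s -> u ->]. Qed.

Lemma sat_subst p rho sigma f g :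
  sat rho sigma (subst f g p) <-> sat (fun i => eval rho (f i)) (sigma \o g) p.
Proof.
elim: p rho sigma f g => //=.
- by move=> s t rho sigma f g; rewrite !eval_subst.
- by move=> s t rho sigma f g; rewrite !eval_subst.
- by move=> t X rho sigma f g; rewrite !eval_subst.
- by move=> p IHp q IHq rho sigma f g; rewrite IHp IHq.
- move=> p IH rho sigma f g.
  have E d : sat (scons d rho) sigma (subst (upN f) g p) <->
             sat (scons d (fun i => eval rho (f i))) (sigma \o g) p.
    by rewrite IH; apply: sat_ext => // -[|i] //=; rewrite eval_subst.
  by split=> H d; apply/E.
- move=> p IH rho sigma f g.
  have E D : sat rho (scons D sigma) (subst f (upS g) p) <->
             sat (fun i => eval rho (f i)) (scons D (sigma \o g)) p.
    by rewrite IH; apply: sat_ext => // -[|i].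
  by split=> H d; apply/E.
Qed.

Lemma sat_substN p rho sigma f :
  sat rho sigma (substN f p) <-> sat (fun i => eval rho (f i)) sigma p.
Proof. exact: sat_subst. Qed.

Lemma sat_substS p rho sigma g :
  sat rho sigma (substS g p) <-> sat rho (sigma \o g) p.
Proof. exact: sat_subst. Qed.

End Satisfaction.

(** * Completeness *)

Fixpoint tree_of_term (t : term) : GenTree.tree nat :=
  match t with
  | Var i => GenTree.Leaf i
  | Zero => GenTree.Node 0 [::]
  | One => GenTree.Node 1 [::]
  | Add s u => GenTree.Node 2 [:: tree_of_term s; tree_of_term u]
  | Mul s u => GenTree.Node 3 [:: tree_of_term s; tree_of_term u]
  end.

Fixpoint tree_of_formula (p : formula) : GenTree.tree nat :=
  match p with
  | Bot => GenTree.Node 0 [::]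
  | Equal s t => GenTree.Node 1 [:: tree_of_term s; tree_of_term t]
  | Less s t => GenTree.Node 2 [:: tree_of_term s; tree_of_term t]
  | Mem t X => GenTree.Node 3 [:: tree_of_term t; GenTree.Leaf X]
  | Imp q r => GenTree.Node 4 [:: tree_of_formula q; tree_of_formula r]
  | AllN q => GenTree.Node 5 [:: tree_of_formula q]
  | AllS q => GenTree.Node 6 [:: tree_of_formula q]
  end.

Lemma tree_of_term_inj : injective tree_of_term.
Proof.
elim=> [i|||s IHs u IHu|s IHs u IHu] [j|||s' u'|s' u'] //=.
- by case=> ->.
- by case=> /IHs -> /IHu ->.
- by case=> /IHs -> /IHu ->.
Qed.

Lemma tree_of_formula_inj : injective tree_of_formula.
Proof.
elim=> [|s t|s t|t X|p IHp q IHq|p IHp|p IHp] [|s' t'|s' t'|t' X'|p' q'|p'|p'] //=.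
- by case=> /tree_of_term_inj -> /tree_of_term_inj ->.
- by case=> /tree_of_term_inj -> /tree_of_term_inj ->.
- by case=> /tree_of_term_inj -> ->.
- by case=> /IHp -> /IHq ->.
- by case=> /IHp ->.
- by case=> /IHp ->.
Qed.

Lemma formula_enumerable : exists e : nat -> formula, forall p, exists n, e n = p.
Proof.
pose c p := pickle (tree_of_formula p).
have c_inj : injective c.
  by move=> p q /(pcan_inj pickleK) /tree_of_formula_inj.
exists (fun n => if pselect (exists p, c p = n) is left E then sval (cid E) else Bot).
move=> p; exists (c p); case: pselect => [E|[]]; last by exists p.
by apply: c_inj; case: cid.
Qed.

(** * Maximal consistent extensions with witnesses, and their term models *)

Section Henkin.
Variables (T : formula -> Prop) (e : nat -> formula) (G0 : list formula).
Hypothesis e_surj : forall p, exists n, e n = p.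
Hypothesis G0_con : ~ prv T G0 Bot.

(** A counterexample for a negated universal formula of either sort; other formulas get the harmless
    value [p]. *)
Definition witness (x : nat) (p : formula) : formula :=
  match p with
  | Imp (AllN q) Bot => Neg (instN (Var x) q)
  | Imp (AllS q) Bot => Neg (instS x q)
  | _ => p
  end.

Definition fresh (G : list formula) : nat := sval (cid (fresh_exists G)).

Definition henkin_step (G : list formula) (p : formula) : list formula :=
  if pselect (prv T (p :: G) Bot) then G
  else witness (fresh (p :: G)) p :: p :: G.

Lemma witness_con x G p : freshN x G -> freshS x G -> List.In p G ->
  prv T G p -> prv T G (Neg (witness x p)) -> prv T G Bot.
Proof.
move=> xN xS.
have absurd q : prv T G q -> prv T G (Neg q) -> prv T G Bot by move=> Hq /prv_impE; apply.
case: p; try by [move=> _; exact: absurd | move=> ? _; exact: absurd | move=> ? ? _; exact: absurd].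
move=> q r; case: q; try by [move=> _; exact: absurd | move=> ? _; exact: absurd | move=> ? ? _; exact: absurd].
all: move=> q; case: r; try by [move=> _; exact: absurd | move=> ? _; exact: absurd | move=> ? ? _; exact: absurd].
- move=> Gp Hp H; apply: (prv_impE Hp); apply: (prv_allN_fresh xN).
    by have := xN _ Gp; rewrite /= maxn0.
  by apply: prv_raa; apply: (prv_impE (prv_weaken1 _ H) (prv_assum _ _ _)).
- move=> Gp Hp H; apply: (prv_impE Hp); apply: (prv_allS_fresh xS).
    by have := xS _ Gp; rewrite /= maxn0.
  by apply: prv_raa; apply: (prv_impE (prv_weaken1 _ H) (prv_assum _ _ _)).
Qed.

Lemma henkin_step_con G p : ~ prv T G Bot -> ~ prv T (henkin_step G p) Bot.
Proof.
rewrite /henkin_step; case: pselect => // pG _ /= /prv_impI H; apply: (pG).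
have [xN xS] : freshN (fresh (p :: G)) (p :: G) /\ freshS (fresh (p :: G)) (p :: G).
  by rewrite /fresh; case: cid.
by apply: (witness_con xN xS _ _ H); [left|apply: prv_assum].
Qed.

Fixpoint henkin (n : nat) : list formula :=
  if n is k.+1 then henkin_step (henkin k) (e k) else G0.

Lemma henkin_con n : ~ prv T (henkin n) Bot.
Proof. by elim: n => //= n; apply: henkin_step_con. Qed.

Lemma henkin_mono m n : m <= n -> List.incl (henkin m) (henkin n).
Proof.
elim: n => [|n IH]; first by rewrite leqn0 => /eqP ->.
rewrite leq_eqVlt => /orP[/eqP -> //|]; rewrite ltnS => /IH sub p Hp.
move/sub: Hp => /= Hp.
by rewrite /henkin_step; case: pselect => //= pG; do 2 right.
Qed.

Definition Th (p : formula) : Prop := exists n, prv T (henkin n) p.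

Lemma Th0 p : prv T [::] p -> Th p.
Proof. by exists 0; apply: prv_weaken0. Qed.

Lemma Th_app p q r :
  (forall G, prv T G p -> prv T G q -> prv T G r) -> Th p -> Th q -> Th r.
Proof.
move=> H [m Hp] [n Hq]; exists (maxn m n); apply: H.
  by apply: prv_weaken Hp _ (henkin_mono _); lia.
by apply: prv_weaken Hq _ (henkin_mono _); lia.
Qed.

Lemma Th_app1 p r : (forall G, prv T G p -> prv T G r) -> Th p -> Th r.
Proof. by move=> H [n Hp]; exists n; apply: H. Qed.

Lemma Th_Bot : ~ Th Bot.
Proof. by case=> n; apply: henkin_con. Qed.

Lemma Th_step p : Th (Neg p) \/ (exists x, Th p /\ Th (witness x p)).
Proof.
have [n En] := e_surj p.
have := erefl (henkin_step (henkin n) p); rewrite {1}/henkin_step.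
case: pselect => [H _|pG E]; first by left; exists n; apply: prv_impI.
right; exists (fresh (p :: henkin n)).
by split; exists n.+1; rewrite /= En -E; apply: prv_hyp; [right; left|left].
Qed.

Lemma Th_EM p : Th p \/ Th (Neg p).
Proof. by case: (Th_step p) => [|[x []]]; [right|left]. Qed.

Lemma Th_MP p q : Th (Imp p q) -> Th p -> Th q.
Proof. by apply: Th_app => G; apply: prv_impE. Qed.

Lemma Th_imp p q : Th (Imp p q) <-> (Th p -> Th q).
Proof.
split; first exact: Th_MP.
case: (Th_EM p) => [Hp H|Hp _].
  by apply: Th_app1 (H Hp) => G; move/(prv_weaken1 p)/prv_impI.
apply: Th_app1 Hp => G Hp; apply: prv_impI; apply: prv_botE.
by apply: prv_impE (prv_weaken1 _ Hp) (prv_assum _ _ _).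
Qed.

Lemma Th_allN p : Th (AllN p) <-> forall t, Th (instN t p).
Proof.
split=> [H t|H]; first by apply: Th_app1 H => G; apply: prv_allNE.
case: (Th_step (Neg (AllN p))) => [|[x [_ /= Hx]]].
  by apply: Th_app1 => G HG; apply: prv_raa; apply: prv_impE (prv_weaken1 _ HG) (prv_assum _ _ _).
by case: Th_Bot; apply: Th_MP Hx (H _).
Qed.

Lemma Th_allS p : Th (AllS p) <-> forall X, Th (instS X p).
Proof.
split=> [H X|H]; first by apply: Th_app1 H => G; apply: prv_allSE.
case: (Th_step (Neg (AllS p))) => [|[x [_ /= Hx]]].
  by apply: Th_app1 => G HG; apply: prv_raa; apply: prv_impE (prv_weaken1 _ HG) (prv_assum _ _ _).
by case: Th_Bot; apply: Th_MP Hx (H _).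
Qed.

(** Since [sat] reads equality as identity, terms must be divided by provable equality. A class is
    represented by its characteristic predicate, so that extensionality identifies equal classes. *)
Definition tclass : Type := {P : term -> Prop | exists t, P = fun s => Th (Equal t s)}.
Definition cl (t : term) : tclass :=
  exist _ (fun s => Th (Equal t s)) (ex_intro _ t erefl).
Definition repr (x : tclass) : term := sval (cid (svalP x)).

Lemma sval_tclass_inj (x y : tclass) : sval x = sval y -> x = y.
Proof. by case: x y => [P HP] [Q HQ] /= E; apply: eq_exist. Qed.

Lemma cl_eq s t : cl s = cl t <-> Th (Equal s t).
Proof.
split=> [H|H].
  have /(congr1 (fun f => f t)) /= -> : sval (cl s) = sval (cl t) by rewrite H.
  exact/Th0/prv_refl.
apply: sval_tclass_inj; apply/funext => u; apply/propext; split.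
  apply: Th_app H => G; move/prv_eq_sym; exact: prv_eq_trans.
by apply: Th_app H => G; apply: prv_eq_trans.
Qed.

Lemma repr_cl t : Th (Equal (repr (cl t)) t).
Proof.
rewrite /repr; case: cid => s /= /(congr1 (fun f => f t)) /= <-.
exact/Th0/prv_refl.
Qed.

Lemma cl_repr x : cl (repr x) = x.
Proof. by apply: sval_tclass_inj; rewrite /repr; case: cid => t /= ->. Qed.

Definition term_model : structure := {|
  dom := tclass; sets := nat;
  s0 := cl Zero; s1 := cl One;
  sadd x y := cl (Add (repr x) (repr y));
  smul x y := cl (Mul (repr x) (repr y));
  slt x y := Th (Less (repr x) (repr y));
  smem x X := Th (Mem (repr x) X) |}.

Lemma eval_term_model (tau : nat -> term) t :
  eval (M := term_model) (fun i => cl (tau i)) t = cl (subst_term tau t).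
Proof.
elim: t => //= s -> u ->; apply/cl_eq.
  by apply: Th_app (repr_cl _) (repr_cl _) => G; apply: prv_eq_add.
by apply: Th_app (repr_cl _) (repr_cl _) => G; apply: prv_eq_mul.
Qed.

(** Henkin's truth lemma. Every element is the class of a term and every set is a variable, so a
    quantifier over the model amounts to all syntactic instances, which [Th_allN] and [Th_allS]
    handle by means of the witnesses. *)
Lemma sat_term_model p (tau : nat -> term) (sigma : nat -> nat) :
  sat (M := term_model) (fun i => cl (tau i)) sigma p <-> Th (subst tau sigma p).
Proof.
elim: p tau sigma => /=.
- by move=> *; split=> // /Th_Bot.
- by move=> s t tau sigma; rewrite !eval_term_model cl_eq.
- move=> s t tau sigma; rewrite !eval_term_model.
  have Es := repr_cl (subst_term tau s); have Et := repr_cl (subst_term tau t).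
  split=> H.
    have /Th_app : forall G, prv T G (Equal (repr (cl (subst_term tau s))) (subst_term tau s)) ->
      prv T G (Less (repr (cl (subst_term tau s))) (repr (cl (subst_term tau t)))) ->
      prv T G (Less (subst_term tau s) (repr (cl (subst_term tau t)))).
      by move=> G E1; apply: prv_eq_less => //; apply: prv_refl.
    move=> /(_ Es H); apply: Th_app Et => G E2; apply: prv_eq_less => //; exact: prv_refl.
  have /Th_app : forall G, prv T G (Equal (repr (cl (subst_term tau s))) (subst_term tau s)) ->
      prv T G (Less (subst_term tau s) (subst_term tau t)) ->
      prv T G (Less (repr (cl (subst_term tau s))) (subst_term tau t)).
    by move=> G /prv_eq_sym E1; apply: prv_eq_less => //; apply: prv_refl.
  move=> /(_ Es H); apply: Th_app Et => G /prv_eq_sym E2; apply: prv_eq_less => //; exact: prv_refl.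
- move=> t X tau sigma; rewrite eval_term_model; split.
    by apply: Th_app (repr_cl (subst_term tau t)) => G; apply: prv_eq_mem.
  apply: Th_app (repr_cl (subst_term tau t)) => G /prv_eq_sym; exact: prv_eq_mem.
- by move=> p IHp q IHq tau sigma; rewrite IHp IHq -Th_imp.
- move=> p IH tau sigma; rewrite Th_allN.
  have E t : sat (M := term_model) (scons (cl t) (fun i => cl (tau i))) sigma p <->
             Th (instN t (subst (upN tau) sigma p)).
    rewrite -[instN _ _]/(subst _ id _) subst_comp.
    have -> : subst (fun i => subst_term (fun i0 => if i0 is k.+1 then Var k else t) (upN tau i))
              (id \o sigma) p = subst (scons t tau) sigma p.
      by apply: subst_ext => // -[|i] //=; rewrite subst_term_shift subst_term_id.
    by rewrite -IH; apply: sat_ext => // -[].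
  by split=> [H t|H d]; [apply/E|rewrite -(cl_repr d); apply/E].
- move=> p IH tau sigma; rewrite Th_allS.
  have E X : sat (M := term_model) (fun i => cl (tau i)) (scons X sigma) p <->
             Th (instS X (subst tau (upS sigma) p)).
    rewrite -[instS _ _]/(subst _ _ _) subst_comp.
    have -> : subst (fun i => subst_term Var (tau i))
        ((fun i => if i is k.+1 then k else X) \o upS sigma) p = subst tau (scons X sigma) p.
      by apply: subst_ext => [i|[|i]] //=; rewrite subst_term_id.
    exact: IH.
  by split=> H X; apply/E.
Qed.

(** An arbitrary assignment becomes a substitution by representatives, under which theorems of the
    empty context are closed. *)
Lemma term_model_models : models term_model T.
Proof.
move=> p Tp rho sigma.
rewrite (@sat_ext term_model _ _ (fun i => cl (repr (rho i))) _ sigma) //; last first.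
  by move=> i; rewrite cl_repr.
by apply/sat_term_model/Th0/prv_subst0/prv_ax.
Qed.

Lemma term_model_base p : List.In p G0 -> sat (M := term_model) (fun i => cl (Var i)) id p.
Proof. by move=> Gp; apply/sat_term_model; rewrite subst_id; exists 0; apply: prv_hyp. Qed.

End Henkin.

Theorem completeness (T : formula -> Prop) (p : formula) :
  (forall M : structure, models M T -> forall rho sigma, @sat M rho sigma p) ->
  proves T p.
Proof.
move=> valid; apply: contrapT => Hp.
have [e e_surj] := formula_enumerable.
have con : ~ prv T [:: Neg p] Bot by move=> H; apply/Hp/prv_raa.
have := term_model_base (T := T) (e := e) e_surj con (p := Neg p) (or_introl erefl).
by apply; apply: valid; apply: term_model_models.
Qed.

(** * Semantics of the derived connectives *)

Section Connectives.
Variables (M : structure) (rho : nat -> M) (sigma : nat -> sets M).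

Lemma sat_and p q : sat rho sigma (And p q) <-> sat rho sigma p /\ sat rho sigma q.
Proof.
split=> /= [H|[Hp Hq] H]; last exact: (H Hp Hq).
by split; apply: contrapT => nH; apply: H => Hp // Hq; apply: nH.
Qed.

Lemma sat_or p q : sat rho sigma (Or p q) <-> sat rho sigma p \/ sat rho sigma q.
Proof.
split=> /= [H|[Hp nH|//]]; last by case: nH.
by case: (EM (sat rho sigma p)) => [|/H]; [left|right].
Qed.

Lemma sat_iff p q : sat rho sigma (Iff p q) <-> (sat rho sigma p <-> sat rho sigma q).
Proof. by rewrite sat_and; split=> -[]. Qed.

Lemma sat_exN p : sat rho sigma (ExN p) <-> exists d, sat (scons d rho) sigma p.
Proof.
split=> /= [H|[d Hd] H]; last exact: (H d Hd).
by apply: contrapT => nH; apply: H => d Hd; apply: nH; exists d.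
Qed.

Lemma sat_exS p : sat rho sigma (ExS p) <-> exists D, sat rho (scons D sigma) p.
Proof.
split=> /= [H|[d Hd] H]; last exact: (H d Hd).
by apply: contrapT => nH; apply: H => d Hd; apply: nH; exists d.
Qed.

Lemma sat_instN t p :
  sat rho sigma (instN t p) <-> sat (scons (eval rho t) rho) sigma p.
Proof. by rewrite sat_substN; apply: sat_ext => // -[]. Qed.

End Connectives.

Lemma bounded_subst p f g : bounded p -> bounded (subst f g p).
Proof.
move=> H; elim: H f g => {p} /=; try by constructor.
by move=> t p _ IH f g; rewrite upN_shift; constructor.
Qed.

(** * Definable predicates and functions

   [ctx M E] says that [E] is a nested product of copies of [M], whose
   coordinates serve as the free variables of a definition; coordinate 0 is the
   rightmost one. *)

Class ctx (M : structure) (E : Type) := coords : nat -> E -> M.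
#[global] Instance ctx_base (M : structure) : ctx M (dom M) := fun _ x => x.
#[global] Instance ctx_prod (M : structure) (E : Type) (cE : ctx M E) :
  ctx M (E * dom M) := fun i e => if i is k.+1 then coords k e.1 else e.2.

Section Delta0.
Variable M : structure.

(* A variable of a defining formula is assigned a coordinate or a parameter. *)
Definition ev {E} {cE : ctx M E} (v : nat + M) (e : E) : M :=
  match v with inl j => coords j e | inr c => c end.

Definition pol {E} {cE : ctx M E} (f : E -> M) : Prop :=
  exists t (v : nat -> nat + M), forall e, f e = eval (fun i => ev (v i) e) t.

Definition D0 {E} {cE : ctx M E} (P : E -> Prop) : Prop :=
  exists q (v : nat -> nat + M) sigma, bounded q /\
    forall e, P e <-> sat (fun i => ev (v i) e) sigma q.

(** Two definitions come with unrelated assignments. Sending the variables of one to even and those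
    of the other to odd indices makes them share an assignment without interference. *)
Definition merge {A : Type} (v w : nat -> A) (i : nat) : A :=
  if odd i then w i./2 else v i./2.

Lemma mergel {A : Type} (v w : nat -> A) i : merge v w i.*2 = v i.
Proof. by rewrite /merge odd_double doubleK. Qed.

Lemma merger {A : Type} (v w : nat -> A) i : merge v w i.*2.+1 = w i.
Proof. by rewrite /merge /= odd_double /= uphalf_double. Qed.

Lemma pol_common {E} {cE : ctx M E} (f g : E -> M) : pol f -> pol g ->
  exists s t (v : nat -> nat + M),
    (forall e, f e = eval (fun i => ev (v i) e) s) /\
    (forall e, g e = eval (fun i => ev (v i) e) t).
Proof.
move=> [s [v Hf]] [t [w Hg]].
exists (subst_term (fun i => Var i.*2) s), (subst_term (fun i => Var i.*2.+1) t), (merge v w).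
split=> e; rewrite ?Hf ?Hg eval_subst; apply: eval_ext => i /=.
  by rewrite mergel.
by rewrite merger.
Qed.

Lemma D0_common {E} {cE : ctx M E} (P Q : E -> Prop) : D0 P -> D0 Q ->
  exists p q (v : nat -> nat + M) sigma, [/\ bounded p, bounded q,
    forall e, P e <-> sat (fun i => ev (v i) e) sigma p &
    forall e, Q e <-> sat (fun i => ev (v i) e) sigma q].
Proof.
move=> [p [v [sigma [bp Hp]]]] [q [w [tau [bq Hq]]]].
exists (subst (fun i => Var i.*2) (fun i => i.*2) p).
exists (subst (fun i => Var i.*2.+1) (fun i => i.*2.+1) q).
exists (merge v w), (merge sigma tau); split; try exact: bounded_subst.
- by move=> e; rewrite Hp sat_subst; apply: sat_ext => i /=; rewrite mergel.
- by move=> e; rewrite Hq sat_subst; apply: sat_ext => i /=; rewrite merger.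
Qed.

Section Closure.
Context {E : Type} {cE : ctx M E}.
Implicit Types (f g : E -> M) (P Q : E -> Prop).

Lemma pol_coord i : pol (coords (E := E) i).
Proof. by exists (Var 0), (fun _ => inl i). Qed.
Lemma pol_const c : pol (fun _ : E => c).
Proof. by exists (Var 0), (fun _ => inr c). Qed.
Lemma pol_add f g : pol f -> pol g -> pol (fun e => sadd (f e) (g e)).
Proof.
move=> Hf Hg; have [s [t [v [Hs Ht]]]] := pol_common Hf Hg.
by exists (Add s t), v => e; rewrite Hs Ht.
Qed.
Lemma pol_mul f g : pol f -> pol g -> pol (fun e => smul (f e) (g e)).
Proof.
move=> Hf Hg; have [s [t [v [Hs Ht]]]] := pol_common Hf Hg.
by exists (Mul s t), v => e; rewrite Hs Ht.
Qed.

Lemma D0_iff P Q : (forall e, P e <-> Q e) -> D0 P -> D0 Q.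
Proof.
by move=> H [q [v [s [bq Hq]]]]; exists q, v, s; split=> // e; rewrite -H.
Qed.

(* The set assignment must be inhabited even if no set is mentioned. *)
Lemma D0_eq (D : sets M) f g : pol f -> pol g -> D0 (fun e => f e = g e).
Proof.
move=> Hf Hg; have [s [t [v [Hs Ht]]]] := pol_common Hf Hg.
by exists (Equal s t), v, (fun _ => D); split=> [|e]; [constructor|rewrite /= Hs Ht].
Qed.
Lemma D0_lt (D : sets M) f g : pol f -> pol g -> D0 (fun e => slt (f e) (g e)).
Proof.
move=> Hf Hg; have [s [t [v [Hs Ht]]]] := pol_common Hf Hg.
by exists (Less s t), v, (fun _ => D); split=> [|e]; [constructor|rewrite /= Hs Ht].
Qed.
Lemma D0_mem (D : sets M) f : pol f -> D0 (fun e => smem (f e) D).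
Proof.
move=> [t [v Hv]]; exists (Mem t 0), v, (fun _ => D).
by split=> [|e]; [constructor|rewrite /= Hv].
Qed.
Lemma D0_False (D : sets M) : D0 (fun _ : E => False).
Proof. by exists Bot, (fun _ => inl 0), (fun _ => D); split=> //; constructor. Qed.
Lemma D0_imp P Q : D0 P -> D0 Q -> D0 (fun e => P e -> Q e).
Proof.
move=> HP HQ; have [p [q [v [s [bp bq Hp Hq]]]]] := D0_common HP HQ.
by exists (Imp p q), v, s; split=> [|e]; [constructor|rewrite /= Hp Hq].
Qed.

(** Variables of the matrix that stand for the last coordinate are all identified with the newly
    bound variable; the others move to even indices, those of the bounding term to odd ones. *)
Lemma D0_all (P : E -> M -> Prop) f :
  pol f -> D0 (fun e : E * M => P e.1 e.2) ->
  D0 (fun e => forall y, slt y (f e) -> P e y).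
Proof.
move=> [t [u Ht]] [q [v [s [bq Hq]]]].
pose t' := subst_term (fun i => Var i.*2.+1) t.
pose r i := if v i is inl 0 then Var 0 else Var i.*2.+1.
pose w := merge (fun i => match v i with inl j => inl j.-1 | inr c => inr c end) u.
exists (AllN (Imp (Less (Var 0) (shift_term t')) (substN r q))), w, s; split.
  by constructor; apply: bounded_subst.
have Et e y : eval (scons y (fun i => ev (w i) e)) (shift_term t') = f e.
  rewrite Ht eval_subst eval_subst; apply: eval_ext => i /=.
  by rewrite /w merger.
have Eq e y : P e y <-> sat (scons y (fun i => ev (w i) e)) s (substN r q).
  rewrite (Hq (e, y)) sat_substN; apply: sat_ext => // i; rewrite /r.
  by case Ev: (v i) => [[|j]|c] //=; rewrite /w mergel Ev.
by move=> e; split=> /= H y; [rewrite -/(shift_term _) Et -Eq|rewrite Eq -(Et e y)]; apply: H.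
Qed.

End Closure.

End Delta0.

(** * Σ1 induction and Δ1 comprehension for definable predicates *)

Section Sigma1Raw.
Variable M : structure.
Hypothesis HM : models M RCA0.

(* Turns the assignment of a formula over [M * M] into one in which the witness
   has index 0, the argument index 1 and the parameters come last. *)
Let ren (v : nat -> nat + M) (i : nat) : term :=
  match v i with inl 0 => Var 0 | inl _ => Var 1 | inr _ => Var i.+2 end.
Let par (v : nat -> nat + M) (i : nat) : M := if v i is inr c then c else s0 M.

Let sat_ren v x y sigma q :
  sat (fun i => ev (v i) (x, y)) sigma q <->
  sat (scons y (scons x (par v))) sigma (substN (ren v) q).
Proof.
rewrite sat_substN; apply: sat_ext => // i.
by rewrite /ren /=; case Ev: (v i) => [[|j]|c] //=; rewrite /par Ev.
Qed.

Lemma D0_sigma_induction (R : M * M -> Prop) : D0 R ->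
  (exists y, R (s0 M, y)) ->
  (forall x, (exists y, R (x, y)) -> exists y, R (sadd x (s1 M), y)) ->
  forall x, exists y, R (x, y).
Proof.
move=> [q [v [s [bq Hq]]]] H0 HS x.
pose p := ExN (substN (ren v) q).
have Ep z : sat (scons z (par v)) s p <-> exists y, R (z, y).
  by rewrite sat_exN; split=> -[y Hy]; exists y; move: Hy; rewrite Hq sat_ren.
have Sp : RCA0 (induction p).
  by apply: RCA0_induction; eexists; split; last reflexivity; apply: bounded_subst.
have H : sat (par v) s (And (instN Zero p)
    (AllN (p ⇒ substN (fun i => match i with 0 => 0 ⊕ One | S k => S k end) p))) ->
  sat (par v) s (AllN p) := HM Sp (par v) s.
apply/Ep; apply: H; apply/sat_and; split; first by apply/sat_instN/Ep.
move=> z /Ep /HS /Ep Hz.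
apply: (proj2 (@sat_substN _ p (scons z (par v)) s (fun i => if i is k.+1 then Var k.+1 else Add (Var 0) One))).
by apply: (proj1 (@sat_ext _ p _ _ _ _ _ _)) Hz => // -[].
Qed.

Lemma D0_comprehension (R Q : M * M -> Prop) : D0 R -> D0 Q ->
  (forall x, (exists y, R (x, y)) <-> forall y, Q (x, y)) ->
  exists D, forall x, smem x D <-> exists y, R (x, y).
Proof.
move=> HR HQ H; have [r [q [v [s [br bq Hr Hq]]]]] := D0_common HR HQ.
pose p := ExN (substN (ren v) r).
pose p' := AllN (substN (ren v) q).
have Ep z : sat (scons z (par v)) s p <-> exists y, R (z, y).
  by rewrite sat_exN; split=> -[y Hy]; exists y; move: Hy; rewrite Hr sat_ren.
have Ep' z : sat (scons z (par v)) s p' <-> forall y, Q (z, y).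
  by split=> Hz y; move: (Hz y); rewrite Hq sat_ren.
have Sp : RCA0 (comprehension p p').
  apply: RCA0_comprehension; eexists; split; try reflexivity; exact: bounded_subst.
have HC : sat (par v) s (AllN (p ⇔ p')) ->
  sat (par v) s (ExS (AllN (Iff (Mem 0 0) (shiftS p)))) := HM Sp (par v) s.
have /HC/sat_exS [D HD] : sat (par v) s (AllN (p ⇔ p')).
  by move=> z; apply/sat_iff; rewrite Ep Ep'.
exists D => x; rewrite -Ep; apply: iff_trans (proj1 (sat_iff (scons x (par v)) (scons D s) (Mem (Var 0) 0) (shiftS p)) (HD x)) _.
exact: sat_substS.
Qed.

End Sigma1Raw.

(** * Arithmetic in a model *)

(* Discretely ordered semirings; discreteness is a consequence of [dltE]. *)
Record dosr : Type := Dosr {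
  car :> Type;
  d0 : car;
  d1 : car;
  dadd : car -> car -> car;
  dmul : car -> car -> car;
  dlt : car -> car -> Prop;
  daddC : commutative dadd;
  daddA : associative dadd;
  dadd0 : right_id d0 dadd;
  dmulC : commutative dmul;
  dmulA : associative dmul;
  dmul1 : right_id d1 dmul;
  dmul0 : right_zero d0 dmul;
  dmulDr : right_distributive dmul dadd;
  daddI : left_injective dadd;
  dsucc_neq0 : forall x, dadd x d1 <> d0;
  dltE : forall x y, dlt x y <-> exists z, y = dadd (dadd x z) d1;
  dlt_total : forall x y, dlt x y \/ x = y \/ dlt y x }.

Section Delta0Connectives.
Context {M : structure} {E : Type} {cE : ctx M E} (D : sets M).
Implicit Types P Q : E -> Prop.

Lemma D0_not P : D0 P -> D0 (fun e => ~ P e).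
Proof. by move=> HP; apply: D0_imp => //; exact: D0_False. Qed.
Lemma D0_or P Q : D0 P -> D0 Q -> D0 (fun e => P e \/ Q e).
Proof.
move=> HP HQ; apply: D0_iff (D0_imp (D0_not HP) HQ) => e.
by split=> [H|[]//]; case: (EM (P e)) => [|/H]; [left|right].
Qed.
Lemma D0_and P Q : D0 P -> D0 Q -> D0 (fun e => P e /\ Q e).
Proof.
move=> HP HQ; apply: D0_iff (D0_not (D0_imp HP (D0_not HQ))) => e.
by split=> [/not_implyP[? /contrapT]|[? ?] H] //; apply: H.
Qed.

End Delta0Connectives.

Lemma D0_ex {M : structure} {E : Type} {cE : ctx M E} (D : sets M)
    (P : E -> M -> Prop) (f : E -> M) :
  pol f -> D0 (fun e : E * M => P e.1 e.2) ->
  D0 (fun e => exists y, slt y (f e) /\ P e y).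
Proof.
move=> Hf HP; have := D0_not D (D0_all (P := fun e y => ~ P e y) Hf (D0_not D HP)).
apply: D0_iff => e; split.
  by move=> H; apply: contrapT => nH; apply: H => y Hy Py; apply: nH; exists y.
by move=> [y [Hy Py]] H; apply: H Hy Py.
Qed.

(** * The axioms make the numbers of the model a discretely ordered semiring *)

Section Peano.
Variables (M : structure) (D : sets M).
Hypothesis HM : models M RCA0.

Declare Scope arith_scope.
Delimit Scope arith_scope with A.
Local Notation "x + y" := (sadd x y) : arith_scope.
Local Notation "x * y" := (smul x y) : arith_scope.
Local Notation "x < y" := (slt x y) : arith_scope.
Local Notation "0" := (s0 M) : arith_scope.
Local Notation "1" := (s1 M) : arith_scope.
Local Open Scope arith_scope.
Implicit Types x y z : M.

Let basic p : basic_axiom p -> forall x y, sat (scons x (fun _ => y)) (fun _ => D) p.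
Proof. by move=> Hp x y; apply: HM; apply: RCA0_basic. Qed.

Let succ_neq0 x : x + 1 <> 0.
Proof. exact: (basic ax_succ_neq0 x x). Qed.
Let succ_inj x y : x + 1 = y + 1 -> x = y.
Proof. exact: (basic ax_succ_inj x y). Qed.
Let add0 x : x + 0 = x.
Proof. exact: (basic ax_add0 x x). Qed.
Let addS x y : x + (y + 1) = x + y + 1.
Proof. exact: (basic ax_addS x y). Qed.
Let mul0 x : x * 0 = 0.
Proof. exact: (basic ax_mul0 x x). Qed.
Let mulS x y : x * (y + 1) = x * y + x.
Proof. exact: (basic ax_mulS x y). Qed.
Let lt0 x : ~ x < 0.
Proof. exact: (basic ax_lt0 x x). Qed.
Let ltS x y : x < y + 1 <-> x < y \/ x = y.
Proof.
apply: iff_trans (proj1 (sat_iff _ _ _ _) (basic ax_ltS x y)) _.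
exact: sat_or.
Qed.

Let D0_ind (P : M -> Prop) : D0 P -> P 0 -> (forall x, P x -> P (x + 1)) -> forall x, P x.
Proof.
move=> [q [v [s [bq Hq]]]] P0 PS x.
(* A bounded predicate is Σ1 with a dummy witness, so Σ1 induction covers it. *)
have R : D0 (fun e : M * M => P e.1).
  exists q, (fun i => match v i with inl j => inl j.+1 | inr c => inr c end), s.
  split=> // -[y w]; rewrite Hq; apply: sat_ext => // i.
  by case: (v i).
have [] := D0_sigma_induction HM R _ _ x => //; first by exists 0.
by move=> y [w /PS Hy]; exists 0.
Qed.

Ltac poltac := repeat first [apply: pol_add | apply: pol_mul | apply: pol_const
  | exact: (pol_coord 0) | exact: (pol_coord 1)].
Ltac d0tac := repeat first [apply: D0_imp | apply: (D0_or D) | apply: (D0_eq D); poltac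
  | apply: (D0_lt D); poltac].

Let add0l x : 0 + x = x.
Proof.
move: x; apply: D0_ind; first by d0tac.
  exact: add0.
by move=> x IH; rewrite addS IH.
Qed.

Let addSl x y : x + 1 + y = x + y + 1.
Proof.
move: y; apply: D0_ind; first by d0tac.
  by rewrite !add0.
by move=> y IH; rewrite !addS IH.
Qed.

Let addC x y : x + y = y + x.
Proof.
move: y; apply: D0_ind; first by d0tac.
  by rewrite add0 add0l.
by move=> y IH; rewrite addS addSl IH.
Qed.

Let addA x y z : x + (y + z) = x + y + z.
Proof.
move: z; apply: D0_ind; first by d0tac.
  by rewrite !add0.
by move=> z IH; rewrite !addS IH.
Qed.

Let mul0l x : 0 * x = 0.
Proof.
move: x; apply: D0_ind; first by d0tac.
  exact: mul0.
by move=> x IH; rewrite mulS IH add0.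
Qed.

Let mulSl x y : (x + 1) * y = x * y + y.
Proof.
move: y; apply: D0_ind; first by d0tac.
  by rewrite !mul0 add0.
by move=> y IH; rewrite !mulS IH !addS; congr (_ + _); rewrite -!addA (addC y).
Qed.

Let mulC x y : x * y = y * x.
Proof.
move: y; apply: D0_ind; first by d0tac.
  by rewrite mul0 mul0l.
by move=> y IH; rewrite mulS mulSl IH.
Qed.

Let mulDr x y z : x * (y + z) = x * y + x * z.
Proof.
move: z; apply: D0_ind; first by d0tac.
  by rewrite mul0 !add0.
by move=> z IH; rewrite addS !mulS IH addA.
Qed.

Let mulA x y z : x * (y * z) = x * y * z.
Proof.
move: z; apply: D0_ind; first by d0tac.
  by rewrite !mul0.
by move=> z IH; rewrite !mulS mulDr IH.
Qed.

Let mul1 x : x * 1 = x.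
Proof. by rewrite -(add0l 1) mulS mul0 add0l. Qed.

Let addI z x y : x + z = y + z -> x = y.
Proof.
move: z; apply: D0_ind; first by d0tac.
  by rewrite !add0.
by move=> z IH; rewrite !addS => /succ_inj.
Qed.

Let zero_or_succ x : x = 0 \/ exists y, x = y + 1.
Proof.
suff [y [->|->]] : exists y, x = 0 \/ x = y + 1 by [left|right; exists y].
apply: (D0_sigma_induction (R := fun e : M * M => e.1 = 0 \/ e.1 = e.2 + 1) HM) => /=.
- by d0tac.
- by exists 0; left.
- by move=> z _; exists z; right.
Qed.

Let ltE x y : x < y <-> exists z, y = x + z + 1.
Proof.
split=> [|[z ->]].
  (* The existential quantifier is moved in front of the implication to give the induction statement
     its Σ1 shape. *)
  move=> Hxy; suff [z Hz] : exists z, x < y -> y = x + z + 1 by exists z; apply: Hz.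
  move: y {Hxy}; apply: (D0_sigma_induction (R := fun e : M * M => x < e.1 -> e.1 = x + e.2 + 1) HM) => /=.
  - by d0tac.
  - by exists 0 => /lt0.
  - move=> y [z Hz]; case: (EM (x < y)) => [/Hz ->|nH].
      by exists (z + 1) => _; rewrite addS.
    by exists 0 => /ltS[//|->]; rewrite add0.
move: z; apply: D0_ind; first by d0tac.
  by rewrite add0; apply/ltS; right.
by move=> z IH; rewrite addS; apply/ltS; left.
Qed.

Let lt_total x y : x < y \/ x = y \/ y < x.
Proof.
move: y; apply: D0_ind; first by d0tac.
  case: (zero_or_succ x) => [->|[z ->]]; first by right; left.
  by right; right; apply/ltE; exists z; rewrite add0l.
move=> y [H|[->|/ltE[z ->]]].
- by left; apply/ltS; left.
- by left; apply/ltS; right.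
- case: (zero_or_succ z) => [->|[w ->]]; first by right; left; rewrite add0.
  by right; right; apply/ltE; exists w; rewrite addSl addS.
Qed.

Definition dosr_of : dosr :=
  {| daddC := addC; daddA := addA; dadd0 := add0; dmulC := mulC; dmulA := mulA;
     dmul1 := mul1; dmul0 := mul0; dmulDr := mulDr; daddI := addI;
     dsucc_neq0 := succ_neq0; dltE := ltE; dlt_total := lt_total |}.

End Peano.

Import Order.TTheory GRing.Theory Num.Theory.
Local Open Scope ring_scope.

HB.instance Definition _ (A : dosr) := gen_eqMixin (car A).
HB.instance Definition _ (A : dosr) := gen_choiceMixin (car A).

Lemma dadd0l (A : dosr) : left_id (d0 A) (@dadd A).
Proof. by move=> x; rewrite daddC dadd0. Qed.
HB.instance Definition _ (A : dosr) :=
  GRing.isNmodule.Build (car A) (@daddA A) (@daddC A) (@dadd0l A).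

Lemma dmul1l (A : dosr) : left_id (d1 A) (@dmul A).
Proof. by move=> x; rewrite dmulC dmul1. Qed.
Lemma dmul0l (A : dosr) : left_zero (d0 A) (@dmul A).
Proof. by move=> x; rewrite dmulC dmul0. Qed.
Lemma dmulDl (A : dosr) : left_distributive (@dmul A) (@dadd A).
Proof. by move=> x y z; rewrite !(dmulC _ z) dmulDr. Qed.
HB.instance Definition _ (A : dosr) :=
  GRing.Nmodule_isComPzSemiRing.Build (car A) (@dmulA A) (@dmulC A) (@dmul1l A)
    (@dmulDl A) (@dmul0l A).


(** * The field of fractions and its order *)

Section Fractions.
Variable A : dosr.
Implicit Types (a b c x y z : A).

Lemma dosr_succ_neq0 x : x + 1 <> 0.
Proof. exact: (@dsucc_neq0 A). Qed.

Lemma dosr_addI z x y : x + z = y + z -> x = y.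
Proof. exact: (@daddI A). Qed.

Lemma dosr_cases x y : (exists z, y = x + z + 1) \/ x = y \/ (exists z, x = y + z + 1).
Proof. by rewrite -!(dltE (d := A)); exact: dlt_total. Qed.

Lemma dosr_add_eq0 x y : x + y = 0 -> x = 0.
Proof.
case: (dosr_cases 0 x) => [[z ->]|[->//|[z H]]] E; case: (@dosr_succ_neq0 (z + y)).
  by rewrite -{1}E; ring.
by case: (@dosr_succ_neq0 (x + z)); rewrite H; ring.
Qed.

(** Cancellation comes from the order: if [v = u + z + 1], then the product with [v] exceeds the one
    with [u] by [z * (c + 1) + c + 1], which is a successor. *)
Lemma dosr_mulI c x y : x * (c + 1) = y * (c + 1) -> x = y.
Proof.
have K u v z : v = u + z + 1 -> u * (c + 1) <> v * (c + 1).
  move=> -> E; case: (@dosr_succ_neq0 (z * (c + 1) + c)).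
  by apply: (@dosr_addI (u * (c + 1))); rewrite add0r [RHS]E; ring.
case: (dosr_cases x y) => [[z /K]|[//|[z /K H /esym]]]; by [].
Qed.

(* [(a, b, c)] stands for [(a - b) / (c + 1)]. *)
Definition feq (s t : A * A * A) : Prop :=
  s.1.1 * (t.2 + 1) + t.1.2 * (s.2 + 1) = t.1.1 * (s.2 + 1) + s.1.2 * (t.2 + 1).

Lemma feq_refl s : feq s s.
Proof. by []. Qed.

Lemma feq_sym s t : feq s t -> feq t s.
Proof. by rewrite /feq => ->. Qed.

Lemma feq_trans s t u : feq s t -> feq t u -> feq s u.
Proof.
case: s t u => [[a b] c] [[a' b'] c'] [[a2 b2] c2]; rewrite /feq /= => H1 H2.
apply: (@dosr_mulI c'); apply: (@dosr_addI (b' * (c + 1) * (c2 + 1))).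
transitivity ((a * (c' + 1) + b' * (c + 1)) * (c2 + 1) + b2 * (c' + 1) * (c + 1)); first by ring.
rewrite H1; transitivity ((a' * (c2 + 1) + b2 * (c' + 1)) * (c + 1) + b * (c' + 1) * (c2 + 1)); first by ring.
by rewrite H2; ring.
Qed.

Definition frac : Type := {P : A * A * A -> Prop | exists t, P = feq t}.
Definition mkf (a b c : A) : frac :=
  exist _ (feq (a, b, c)) (ex_intro _ (a, b, c) erefl).
Definition frep (x : frac) : A * A * A := sval (cid (svalP x)).

Lemma sval_frac_inj (x y : frac) : sval x = sval y -> x = y.
Proof. by case: x y => [P HP] [Q HQ] /= E; apply: eq_exist. Qed.

Lemma mkf_eq a b c a' b' c' :
  mkf a b c = mkf a' b' c' <-> feq (a, b, c) (a', b', c').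
Proof.
split=> [H|H].
  have -> : feq (a, b, c) = feq (a', b', c').
    by rewrite -[LHS]/(sval (mkf a b c)) H.
  exact: feq_refl.
apply: sval_frac_inj; apply/funext => t; apply/propext; split.
  by apply: feq_trans; apply: feq_sym.
exact: feq_trans.
Qed.

Lemma mkf_rep (x : frac) : x = mkf (frep x).1.1 (frep x).1.2 (frep x).2.
Proof. by apply: sval_frac_inj; rewrite /frep; case: cid => -[[a b] c] /= ->. Qed.

Lemma frep_mkf a b c : feq (frep (mkf a b c)) (a, b, c).
Proof.
apply: feq_sym; rewrite /frep; case: cid => t /= ->; exact: feq_refl.
Qed.

Lemma frac_ind (x : frac) : exists a b c, x = mkf a b c.
Proof. by exists (frep x).1.1, (frep x).1.2, (frep x).2; apply: mkf_rep. Qed.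

(** Storing the predecessor of the denominator avoids a side condition; [c * c' + c + c'] is the
    predecessor of [(c + 1) * (c' + 1)]. *)
Definition fadd (x y : frac) : frac :=
  let: (a, b, c) := frep x in let: (a', b', c') := frep y in
  mkf (a * (c' + 1) + a' * (c + 1)) (b * (c' + 1) + b' * (c + 1)) (c * c' + c + c').
Definition fmul (x y : frac) : frac :=
  let: (a, b, c) := frep x in let: (a', b', c') := frep y in
  mkf (a * a' + b * b') (a * b' + b * a') (c * c' + c + c').
Definition fopp (x : frac) : frac :=
  let: (a, b, c) := frep x in mkf b a c.

Lemma faddE a b c a' b' c' : fadd (mkf a b c) (mkf a' b' c') =
  mkf (a * (c' + 1) + a' * (c + 1)) (b * (c' + 1) + b' * (c + 1)) (c * c' + c + c').
Proof.
rewrite /fadd; have := frep_mkf a b c; have := frep_mkf a' b' c'.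
case: (frep (mkf a b c)) => [[u v] w]; case: (frep (mkf a' b' c')) => [[u' v'] w'].
rewrite /feq /= => E' E.
apply/mkf_eq; rewrite /feq /=.
transitivity ((u * (c + 1) + b * (w + 1)) * (w' + 1) * (c' + 1)
  + (u' * (c' + 1) + b' * (w' + 1)) * (w + 1) * (c + 1)); first by ring.
by rewrite E E'; ring.
Qed.

Lemma fmulE a b c a' b' c' : fmul (mkf a b c) (mkf a' b' c') =
  mkf (a * a' + b * b') (a * b' + b * a') (c * c' + c + c').
Proof.
rewrite /fmul; have := frep_mkf a b c; have := frep_mkf a' b' c'.
case: (frep (mkf a b c)) => [[u v] w]; case: (frep (mkf a' b' c')) => [[u' v'] w'].
rewrite /feq /= => E' E.
(* The representatives are exchanged one factor at a time, which keeps each identity linear in the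
   equation used. *)
transitivity (mkf (a * u' + b * v') (a * v' + b * u') (c * w' + c + w')).
  apply/mkf_eq; rewrite /feq /=.
  transitivity (((u * (c + 1) + b * (w + 1)) * u' + (a * (w + 1) + v * (c + 1)) * v')
    * (w' + 1)); first by ring.
  by rewrite E -{2}E; ring.
apply/mkf_eq; rewrite /feq /=.
transitivity (((u' * (c' + 1) + b' * (w' + 1)) * a + (a' * (w' + 1) + v' * (c' + 1)) * b)
    * (c + 1)); first by ring.
by rewrite E' -{2}E'; ring.
Qed.

Lemma foppE a b c : fopp (mkf a b c) = mkf b a c.
Proof.
rewrite /fopp; have := frep_mkf a b c; case: (frep _) => [[u v] w]; rewrite /feq /= => E.
by apply/mkf_eq; rewrite /feq /= addrC -E addrC.
Qed.

Definition finj (a : A) : frac := mkf a 0 0.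

End Fractions.

Ltac frac_elim x := let a := fresh "a" in let b := fresh "b" in let c := fresh "c" in
  case: (frac_ind x) => a [b [c ->]].

HB.instance Definition _ (A : dosr) := gen_eqMixin (frac A).
HB.instance Definition _ (A : dosr) := gen_choiceMixin (frac A).

Section FractionField.
Variable A : dosr.
Implicit Types (x y z : frac A).

Ltac fring := rewrite /finj ?(faddE, fmulE, foppE); apply/mkf_eq; rewrite /feq /=; ring.

Lemma faddA : associative (@fadd A).
Proof. by move=> x y z; frac_elim x; frac_elim y; frac_elim z; fring. Qed.
Lemma faddC : commutative (@fadd A).
Proof. by move=> x y; frac_elim x; frac_elim y; fring. Qed.
Lemma fadd0 : left_id (finj (0 : A)) (@fadd A).
Proof. by move=> x; frac_elim x; fring. Qed.
Lemma faddN : left_inverse (finj (0 : A)) (@fopp A) (@fadd A).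
Proof. by move=> x; frac_elim x; fring. Qed.
Lemma fmulA : associative (@fmul A).
Proof. by move=> x y z; frac_elim x; frac_elim y; frac_elim z; fring. Qed.
Lemma fmulC : commutative (@fmul A).
Proof. by move=> x y; frac_elim x; frac_elim y; fring. Qed.
Lemma fmul1 : left_id (finj (1 : A)) (@fmul A).
Proof. by move=> x; frac_elim x; fring. Qed.
Lemma fmulDl : left_distributive (@fmul A) (@fadd A).
Proof. by move=> x y z; frac_elim x; frac_elim y; frac_elim z; fring. Qed.
Lemma f1_neq0 : finj (1 : A) != finj 0.
Proof.
apply/eqP => /mkf_eq; rewrite /feq /= => E.
apply: (@dosr_succ_neq0 A 0).
by transitivity ((1 : A) * (0 + 1) + 0 * (0 + 1)); [ring|rewrite E; ring].
Qed.

End FractionField.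

HB.instance Definition _ (A : dosr) :=
  GRing.isZmodule.Build (frac A) (@faddA A) (@faddC A) (@fadd0 A) (@faddN A).
HB.instance Definition _ (A : dosr) :=
  GRing.Zmodule_isComNzRing.Build (frac A) (@fmulA A) (@fmulC A) (@fmul1 A)
    (@fmulDl A) (@f1_neq0 A).

Section FractionInverse.
Variable A : dosr.
Implicit Types (x y z : frac A) (a b c : A).

Lemma mkf_eq0 a c : mkf a 0 c = 0 -> a = 0.
Proof.
move/mkf_eq; rewrite /feq /= => E.
by transitivity (a * (0 + 1) + 0 * (c + 1)); [ring|rewrite E; ring].
Qed.

(** A nonzero fraction has [a] and [b] different by some [z + 1], so [c + 1] over [z + 1], with the
    appropriate sign, is its inverse. *)
Lemma frac_inv_exists x : x != 0 -> exists y, y * x == 1.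
Proof.
frac_elim x => /eqP nz.
case: (dosr_cases a b) => [[z E]|[E|[z E]]].
- by exists (mkf 0 (c + 1) z); rewrite E; apply/eqP; rewrite -[LHS]/(fmul _ _); rewrite fmulE; apply/mkf_eq; rewrite /feq /=; ring.
- by case: nz; apply/mkf_eq; rewrite E /feq /=; ring.
- by exists (mkf (c + 1) 0 z); rewrite E; apply/eqP; rewrite -[LHS]/(fmul _ _); rewrite fmulE; apply/mkf_eq; rewrite /feq /=; ring.
Qed.

Definition finv x : frac A :=
  if pselect (exists y, y * x == 1) is left H then xchoose H else 0.

Lemma fmulV x : x != 0 -> finv x * x = 1.
Proof.
move=> nz; rewrite /finv; case: pselect => [H|[]]; last exact: frac_inv_exists.
exact/eqP/(xchooseP H).
Qed.

Lemma finv0 : finv 0 = 0.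
Proof.
rewrite /finv; case: pselect => // H; exfalso; case: H => y; rewrite mulr0 => /eqP E.
by have := oner_neq0 (frac A); rewrite -E eqxx.
Qed.

End FractionInverse.

HB.instance Definition _ (A : dosr) :=
  GRing.ComNzRing_isField.Build (frac A) (@fmulV A) (@finv0 A).

Section FractionOrder.
Variable A : dosr.
Implicit Types (x y z : frac A) (a b c : A).

Definition fnonneg x : Prop := exists a c, x = mkf a 0 c.
Definition fle x y : bool := `[< fnonneg (y - x) >].
Definition flt x y : bool := (y != x) && fle x y.
Definition fnorm x : frac A := if fle 0 x then x else - x.

Lemma fle0E x : fle 0 x <-> fnonneg x.
Proof. by rewrite /fle subr0; split=> [/asboolP|/asboolP]. Qed.

Lemma fle0_add x y : fle 0 x -> fle 0 y -> fle 0 (x + y).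
Proof.
move=> /fle0E [a [c ->]] /fle0E [a' [c' ->]]; apply/fle0E.
exists (a * (c' + 1) + a' * (c + 1)), (c * c' + c + c').
by rewrite -[LHS]/(fadd _ _); rewrite faddE; apply/mkf_eq; rewrite /feq /=; ring.
Qed.

Lemma fle0_mul x y : fle 0 x -> fle 0 y -> fle 0 (x * y).
Proof.
move=> /fle0E [a [c ->]] /fle0E [a' [c' ->]]; apply/fle0E.
exists (a * a'), (c * c' + c + c').
by rewrite -[LHS]/(fmul _ _); rewrite fmulE; apply/mkf_eq; rewrite /feq /=; ring.
Qed.

Lemma fle0_anti x : fle 0 x -> fle x 0 -> x = 0.
Proof.
move=> /fle0E [a [c Ex]]; rewrite /fle sub0r => /asboolP [a' [c' Ex']].
have : x - x = 0 by rewrite subrr.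
rewrite Ex' Ex -[X in X = _ -> _]/(fadd _ _) faddE => E.
have {}E : mkf (a * (c' + 1) + a' * (c + 1)) 0 (c * c' + c + c') = 0.
  rewrite -[RHS]E; apply/mkf_eq; rewrite /feq /=; ring.
have := mkf_eq0 E => /dosr_add_eq0 E'.
have -> : a = 0 by apply: (@dosr_mulI _ c'); rewrite E' mul0r.
by apply/mkf_eq; rewrite /feq /=; ring.
Qed.

Lemma fsub_ge0 x y : fle 0 (y - x) = fle x y.
Proof. by rewrite /fle subr0. Qed.

Lemma fle0_total x : fle 0 x || fle x 0.
Proof.
rewrite -(fsub_ge0 x) sub0r; frac_elim x; apply/orP.
have nn (u v w t : A) : u = v + t -> fle 0 (mkf u v w).
  by move=> ->; apply/fle0E; exists t, w; apply/mkf_eq; rewrite /feq /=; ring.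
rewrite -[- _]/(fopp _) foppE.
case: (dosr_cases a b) => [[z ->]|[->|[z ->]]]; [right|left|left].
- by apply: (nn _ _ _ (z + 1)); rewrite addrA.
- by apply: (nn _ _ _ 0); rewrite addr0.
- by apply: (nn _ _ _ (z + 1)); rewrite addrA.
Qed.

Lemma fnormN x : fnorm (- x) = fnorm x.
Proof.
rewrite /fnorm opprK; have := @fle0_total x; have := @fle0_anti x.
have -> : fle x 0 = fle 0 (- x) by rewrite -fsub_ge0 sub0r.
case: (fle 0 x); case: (fle 0 (- x)) => //= H _.
by rewrite H // oppr0.
Qed.

Lemma fge0_norm x : fle 0 x -> fnorm x = x.
Proof. by rewrite /fnorm => ->. Qed.

Lemma flt_def x y : flt x y = (y != x) && fle x y.
Proof. by []. Qed.

End FractionOrder.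

HB.instance Definition _ (A : dosr) :=
  Num.IntegralDomain_isLeReal.Build (frac A) (@fle0_add A) (@fle0_mul A)
    (@fle0_anti A) (@fsub_ge0 A) (@fle0_total A) (@fnormN A) (@fge0_norm A) (@flt_def A).

Section Embedding.
Variable A : dosr.
Implicit Types (x y : frac A) (a b c : A).

Lemma finj0 : finj (0 : A) = 0. Proof. by []. Qed.
Lemma finj1 : finj (1 : A) = 1. Proof. by []. Qed.
Lemma finjD a b : finj (a + b) = finj a + finj b.
Proof. by rewrite -[RHS]/(fadd _ _) faddE; apply/mkf_eq; rewrite /feq /=; ring. Qed.
Lemma finjM a b : finj (a * b) = finj a * finj b.
Proof. by rewrite -[RHS]/(fmul _ _) fmulE; apply/mkf_eq; rewrite /feq /=; ring. Qed.
Lemma finj_inj : injective (@finj A).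
Proof.
move=> a b /mkf_eq; rewrite /feq /= => E; apply: (@dosr_mulI _ 0); apply: (@dosr_addI _ (0 * (0 + 1))).
exact: E.
Qed.
Lemma finj_ge0 a : 0 <= finj a.
Proof. by apply/fle0E; exists a, 0. Qed.
(** The gap of 1 records discreteness; with it, linear arithmetic in the field settles questions
    about numbers of the model. *)
Lemma finj_lt a b : dlt a b <-> finj a + 1 <= finj b.
Proof.
rewrite dltE; split=> [[z ->]|].
  by rewrite -[dadd _ _]/(a + z + 1) !finjD finj1; have := finj_ge0 z; lra.
case: (dosr_cases a b) => [//|[->|[z ->]]]; first by lra.
by rewrite !finjD finj1; have := finj_ge0 z; lra.
Qed.
End Embedding.

(** * Computable predicates and functions of a model *)

Section NumbersAsFractions.
Variables (M : structure) (D : sets M).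
Hypothesis HM : models M RCA0.
Implicit Types x y z : M.

Definition emb (x : M) : frac (dosr_of D HM) := @finj (dosr_of D HM) x.

Lemma embD x y : emb (sadd x y) = emb x + emb y.
Proof. exact: (@finjD (dosr_of D HM)). Qed.
Lemma embM x y : emb (smul x y) = emb x * emb y.
Proof. exact: (@finjM (dosr_of D HM)). Qed.
Lemma emb0 : emb (s0 M) = 0.
Proof. exact: (@finj0 (dosr_of D HM)). Qed.
Lemma emb1 : emb (s1 M) = 1.
Proof. exact: (@finj1 (dosr_of D HM)). Qed.
Lemma emb_inj x y : emb x = emb y -> x = y.
Proof. exact: (@finj_inj (dosr_of D HM)). Qed.
Lemma emb_ge0 x : 0 <= emb x.
Proof. exact: (@finj_ge0 (dosr_of D HM)). Qed.
Lemma slt_emb x y : slt x y <-> emb x + 1 <= emb y.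
Proof. exact: (@finj_lt (dosr_of D HM)). Qed.
Lemma slt_cases x y : slt x y \/ x = y \/ slt y x.
Proof. exact: (@dlt_total (dosr_of D HM)). Qed.
Lemma nslt_emb x y : ~ slt x y <-> emb y <= emb x.
Proof.
rewrite slt_emb; case: (slt_cases x y) => [/slt_emb|[->|/slt_emb]].
- by split; lra.
- by split; lra.
- by split; lra.
Qed.
Lemma eq_emb x y : x = y <-> emb x = emb y.
Proof. by split=> [->|/emb_inj]. Qed.

End NumbersAsFractions.

Ltac emb_ge0s := repeat match goal with
  | |- context [@emb ?M ?D ?HM ?x] =>
    lazymatch goal with H : is_true (0 <= @emb M D HM x) |- _ => fail | _ =>
      have := @emb_ge0 M D HM x; let H := fresh "ge0" in move=> H end
  | _ : context [@emb ?M ?D ?HM ?x] |- _ =>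
    lazymatch goal with H : is_true (0 <= @emb M D HM x) |- _ => fail | _ =>
      have := @emb_ge0 M D HM x; let H := fresh "ge0" in move=> H end
  end.

(* Moves the goal and the hypotheses to the field of fractions, where [lra] and
   [nra] apply. *)
Ltac to_emb D HM :=
  cbn [fst snd] in *;
  repeat match goal with
  | H : @slt _ _ _ |- _ => move/(@slt_emb _ D HM): H => H
  | H : ~ @slt _ _ _ |- _ => move/(@nslt_emb _ D HM): H => H
  | H : @eq (dom _) _ _ |- _ => move/(@eq_emb _ D HM): H => H
  end;
  try match goal with
  | |- @slt _ _ _ => apply/(@slt_emb _ D HM)
  | |- ~ @slt _ _ _ => apply/(@nslt_emb _ D HM)
  | |- @eq (dom _) _ _ => apply/(@eq_emb _ D HM)
  end;
  rewrite ?(embD, embM, emb0, emb1);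
  repeat match goal with
  | H : context [@emb _ _ _ (sadd _ _)] |- _ => rewrite ?(embD, embM, emb0, emb1) in H
  | H : context [@emb _ _ _ (smul _ _)] |- _ => rewrite ?(embD, embM, emb0, emb1) in H
  | H : context [@emb _ _ _ (s0 _)] |- _ => rewrite ?(embD, embM, emb0, emb1) in H
  | H : context [@emb _ _ _ (s1 _)] |- _ => rewrite ?(embD, embM, emb0, emb1) in H
  end;
  emb_ge0s.

(** * Closure properties of Σ1 and Δ1 predicates and of computable functions *)

Section Computability.
Variables (M : structure) (D : sets M).
Hypothesis HM : models M RCA0.
Local Notation "x ≪ y" := (slt x y) (at level 70).
Local Notation "x '.+' y" := (sadd x y) (at level 50, left associativity).
Implicit Types x y z : M.

Ltac vlra := to_emb D HM; lra.


Lemma D0_comp {E E'} {cE : ctx M E} {cE' : ctx M E'} (h : E' -> E) (P : E -> Prop) :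
  (forall i, exists v, forall e, coords i (h e) = ev v e) ->
  D0 P -> D0 (fun e => P (h e)).
Proof.
move=> Hh [q [v [s [bq Hq]]]]; have [k Hk] := choice Hh.
exists q, (fun i => match v i with inl j => k j | inr c => inr c end), s.
by split=> // e; rewrite Hq; apply: sat_ext => // i; case: (v i) => [j|c] //=.
Qed.

Definition Sig {E} {cE : ctx M E} (P : E -> Prop) : Prop :=
  exists R : E * M -> Prop, D0 R /\ forall e, P e <-> exists y, R (e, y).

Lemma Sig_comp {E E'} {cE : ctx M E} {cE' : ctx M E'} (h : E' -> E) (P : E -> Prop) :
  (forall i, exists v, forall e, coords i (h e) = ev v e) ->
  Sig P -> Sig (fun e => P (h e)).
Proof.
move=> Hh [R [HR HP]]; exists (fun e => R (h e.1, e.2)); split; last by move=> e; rewrite HP.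
apply: (D0_comp (h := fun e : E' * M => (h e.1, e.2))) HR => -[|i]; first by exists (inl 0).
have [[j|c] Hv] := Hh i; [by exists (inl j.+1) => -[e y]; exact: Hv|].
by exists (inr c) => -[e y]; exact: Hv.
Qed.

Lemma Sig_iff {E} {cE : ctx M E} (P Q : E -> Prop) :
  (forall e, P e <-> Q e) -> Sig P -> Sig Q.
Proof. by move=> H [R [HR HP]]; exists R; split=> // e; rewrite -H. Qed.

Lemma Sig_D0 {E} {cE : ctx M E} (P : E -> Prop) : D0 P -> Sig P.
Proof.
move=> HP; exists (fun e => P e.1); split.
  by apply: (D0_comp (h := fst)) HP => i; exists (inl i.+1).
by move=> e; split=> [|[]//]; exists (s0 M).
Qed.

(** Replacing a witness by an upper bound for it lets two existential quantifiers contract to one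
    without decoding pairs. *)
Lemma D0_below {E} {cE : ctx M E} (P : E * M -> Prop) : D0 P ->
  D0 (fun e : E * M => exists y, y ≪ e.2 /\ P (e.1, y)).
Proof.
move=> HP; apply: (D0_ex D); first exact: (pol_coord 0).
apply: (D0_comp (h := fun e : (E * M) * M => (e.1.1, e.2))) HP.
by case=> [|i]; [exists (inl 0)|exists (inl i.+2)].
Qed.

Lemma Sig_and {E} {cE : ctx M E} (P Q : E -> Prop) :
  Sig P -> Sig Q -> Sig (fun e => P e /\ Q e).
Proof.
move=> [R [HR HP]] [S [HS HQ]].
exists (fun e => (exists y, y ≪ e.2 /\ R (e.1, y)) /\ (exists y, y ≪ e.2 /\ S (e.1, y))).
split; first by apply: (D0_and D); apply: D0_below.
move=> e; rewrite HP HQ; split=> [[[y Hy] [z Hz]]|[w [[y [_ Hy]] [z [_ Hz]]]]] /=.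
  by exists (y .+ z .+ s1 M); split; [exists y|exists z]; split=> //; vlra.
by split; [exists y|exists z].
Qed.

Lemma Sig_or {E} {cE : ctx M E} (P Q : E -> Prop) :
  Sig P -> Sig Q -> Sig (fun e => P e \/ Q e).
Proof.
move=> [R [HR HP]] [S [HS HQ]]; exists (fun e => R e \/ S e).
split; first exact: (D0_or D).
move=> e; rewrite HP HQ; split=> [[[y Hy]|[y Hy]]|[y [Hy|Hy]]].
- by exists y; left.
- by exists y; right.
- by left; exists y.
- by right; exists y.
Qed.

Lemma Sig_ex {E} {cE : ctx M E} (P : E -> M -> Prop) :
  Sig (fun e : E * M => P e.1 e.2) -> Sig (fun e => exists x, P e x).
Proof.
move=> [R [HR HP]].
exists (fun e => exists x, x ≪ e.2 /\ exists y, y ≪ e.2 /\ R ((e.1, x), y)); split.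
  apply: (D0_ex D (P := fun e x => exists y, y ≪ e.2 /\ R ((e.1, x), y))); first exact: (pol_coord 0).
  apply: (D0_ex D (P := fun (e : (E * M) * M) y => R ((e.1.1, e.2), y))); first exact: (pol_coord 1).
  apply: (D0_comp (h := fun e : ((E * M) * M) * M => ((e.1.1.1, e.1.2), e.2))) HR.
  by case=> [|[|i]]; [exists (inl 0)|exists (inl 1)|exists (inl i.+3)].
move=> e; split=> [[x /(HP (e, x)) [y Hy]]|[z [x [_ [y [_ Hy]]]]]].
  by exists (x .+ y .+ s1 M), x; split; [vlra|exists y; split=> //; vlra].
by exists x; apply/(HP (e, x)); exists y.
Qed.

Lemma Sig_induction (P : M -> Prop) : Sig P ->
  P (s0 M) -> (forall x, P x -> P (x .+ s1 M)) -> forall x, P x.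
Proof.
move=> [R [HR HP]] P0 PS x; apply/HP; apply: (D0_sigma_induction HM HR).
  exact/HP.
by move=> z /HP /PS /HP.
Qed.

Lemma fix_coords {E E'} {cE : ctx M E} {cE' : ctx M E'} (e : E) i :
  exists v, forall e' : E', coords i e = ev v e'.
Proof. by exists (inr (coords i e)). Qed.

(** Σ1 collection: a common bound on the witnesses is built up by Σ1 induction on the number of
    arguments already treated. *)
Lemma Sig_all {E} {cE : ctx M E} (P : E -> M -> Prop) (f : E -> M) : pol f ->
  Sig (fun e : E * M => P e.1 e.2) -> Sig (fun e => forall x, x ≪ f e -> P e x).
Proof.
move=> Hf [R [HR HP]].
exists (fun e => forall x, x ≪ f e.1 -> exists y, y ≪ e.2 /\ R ((e.1, x), y)); split.
  apply: (D0_all (P := fun e x => exists y, y ≪ e.2 /\ R ((e.1, x), y))).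
    have [t [v Hv]] := Hf.
    exists t, (fun i => match v i with inl j => inl j.+1 | inr c => inr c end) => e.
    by rewrite Hv; apply: eval_ext => i; case: (v i).
  apply: (D0_ex D (P := fun (e : (E * M) * M) y => R ((e.1.1, e.2), y))); first exact: (pol_coord 1).
  apply: (D0_comp (h := fun e : ((E * M) * M) * M => ((e.1.1.1, e.1.2), e.2))) HR.
  by case=> [|[|i]]; [exists (inl 0)|exists (inl 1)|exists (inl i.+3)].
move=> e; split=> [H|[z Hz] x /Hz[y [_ Hy]]]; last by apply/(HP (e, x)); exists y.
suff /(_ (f e)) [|z Hz] : forall n, (forall x, x ≪ n -> x ≪ f e) ->
    exists z, forall x, x ≪ n -> exists y, y ≪ z /\ R ((e, x), y).
- by [].
- by exists z.
move=> n Hn.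
(* The condition that [n] is at most [f e] enters as a negated bounded disjunct inside the
   existential quantifier, which keeps the induction statement Σ1. *)
suff [z [|Hz]] : exists z, ~ (forall x, x ≪ n -> x ≪ f e) \/
    forall x, x ≪ n -> exists y, y ≪ z /\ R ((e, x), y) by [|exists z].
move: n {Hn}; apply: (D0_sigma_induction
  (R := fun w : M * M => ~ (forall x, x ≪ w.1 -> x ≪ f e) \/
    forall x, x ≪ w.1 -> exists y, y ≪ w.2 /\ R ((e, x), y)) HM).
- apply: (D0_or D).
    apply: (D0_not D); apply: D0_all; first exact: (pol_coord 1).
    by apply: (D0_lt D); [exact: (pol_coord 0)|exact: pol_const].
  apply: (D0_all (P := fun w x => exists y, y ≪ w.2 /\ R ((e, x), y))); first exact: (pol_coord 1).
  apply: (D0_ex D (P := fun (w : (M * M) * M) y => R ((e, w.2), y))); first exact: (pol_coord 1).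
  apply: (D0_comp (h := fun w : ((M * M) * M) * M => ((e, w.1.2), w.2))) HR.
  case=> [|[|i]]; [by exists (inl 0)|by exists (inl 1)|exact: fix_coords].
- by exists (s0 M); right=> x Hx; exfalso; vlra.
- move=> n [z IH].
  case: (EM (forall x, x ≪ n .+ s1 M -> x ≪ f e)) => [Hn|]; last by exists z; left.
  case: IH => [[x Hx]|IH /=]; first by apply: Hn; vlra.
  have /H /(HP (e, n)) [y Hy] : n ≪ f e by apply: Hn; vlra.
  exists (z .+ y .+ s1 M); right=> x Hx.
  case: (slt_cases D HM x n) => [/IH[y' [Hy' HR']]|[->|?]].
  + by exists y'; split=> //; vlra.
  + by exists y; split=> //; vlra.
  + by exfalso; vlra.
Qed.

Definition Dl {E} {cE : ctx M E} (P : E -> Prop) : Prop :=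
  Sig P /\ Sig (fun e => ~ P e).
(** As [f] is total, a Σ1 graph is automatically Δ1: another value exists exactly if the given one
    is wrong. *)
Definition Fn {E} {cE : ctx M E} (f : E -> M) : Prop :=
  Sig (fun e : E * M => f e.1 = e.2).

Lemma Dl_D0 {E} {cE : ctx M E} (P : E -> Prop) : D0 P -> Dl P.
Proof. by move=> HP; split; apply: Sig_D0 => //; apply: (D0_not D). Qed.

Lemma Dl_iff {E} {cE : ctx M E} (P Q : E -> Prop) :
  (forall e, P e <-> Q e) -> Dl P -> Dl Q.
Proof. by move=> H [H1 H2]; split; [apply: Sig_iff H1|apply: Sig_iff H2] => e; rewrite H. Qed.

Lemma Dl_comp {E E'} {cE : ctx M E} {cE' : ctx M E'} (h : E' -> E) (P : E -> Prop) :
  (forall i, exists v, forall e, coords i (h e) = ev v e) ->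
  Dl P -> Dl (fun e => P (h e)).
Proof.
move=> Hh [H1 H2]; split; first exact: Sig_comp H1.
exact: (Sig_comp (P := fun e => ~ P e)) H2.
Qed.

Lemma Fn_comp {E E'} {cE : ctx M E} {cE' : ctx M E'} (h : E' -> E) (f : E -> M) :
  (forall i, exists v, forall e, coords i (h e) = ev v e) ->
  Fn f -> Fn (fun e => f (h e)).
Proof.
move=> Hh Hf; apply: (Sig_comp (h := fun e : E' * M => (h e.1, e.2))) Hf.
move=> [|i]; first by exists (inl 0).
have [[j|c] Hv] := Hh i; [by exists (inl j.+1) => -[e y]; exact: Hv|].
by exists (inr c) => -[e y]; exact: Hv.
Qed.

Lemma Fn_pol {E} {cE : ctx M E} (f : E -> M) : pol f -> Fn f.
Proof.
move=> [t [v Hv]]; apply: Sig_D0; apply: (D0_eq D); last exact: (pol_coord 0).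
exists t, (fun i => match v i with inl j => inl j.+1 | inr c => inr c end) => e.
by rewrite Hv; apply: eval_ext => i; case: (v i).
Qed.

Lemma Fn_coord {E} {cE : ctx M E} i : Fn (coords (E := E) i).
Proof. exact/Fn_pol/pol_coord. Qed.
Lemma Fn_const {E} {cE : ctx M E} c : Fn (fun _ : E => c).
Proof. exact/Fn_pol/pol_const. Qed.

Lemma Sig_sub {E} {cE : ctx M E} (P : E -> M -> Prop) (f : E -> M) :
  Sig (fun e : E * M => P e.1 e.2) -> Fn f -> Sig (fun e => P e (f e)).
Proof.
move=> HP Hf; apply: (Sig_iff (P := fun e => exists y, f e = y /\ P e y)).
  by move=> e; split=> [[y [<-]]|]; [|exists (f e)].
by apply: Sig_ex; apply: Sig_and.
Qed.

Lemma Dl_sub {E} {cE : ctx M E} (P : E -> M -> Prop) (f : E -> M) :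
  Dl (fun e : E * M => P e.1 e.2) -> Fn f -> Dl (fun e => P e (f e)).
Proof.
move=> [H1 H2] Hf; split; first exact: Sig_sub.
exact: (Sig_sub (P := fun e y => ~ P e y)).
Qed.

Lemma Fn_sub {E} {cE : ctx M E} (g : E -> M -> M) (f : E -> M) :
  Fn (fun e : E * M => g e.1 e.2) -> Fn f -> Fn (fun e => g e (f e)).
Proof.
move=> Hg Hf; apply: (Sig_sub (P := fun (e : E * M) x => g e.1 x = e.2) (f := fun e : E * M => f e.1)).
  apply: (Sig_comp (h := fun e : (E * M) * M => ((e.1.1, e.2), e.1.2))) Hg.
  by case=> [|[|i]]; [exists (inl 1)|exists (inl 0)|exists (inl i.+2)].
by apply: Fn_comp Hf => i; exists (inl i.+1).
Qed.

Lemma Dl_app1 {E} {cE : ctx M E} (P : M -> Prop) (f : E -> M) :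
  Dl P -> Fn f -> Dl (fun e => P (f e)).
Proof.
move=> HP; apply: (Dl_sub (P := fun e => P)).
by apply: (Dl_comp (h := snd)) HP => i; exists (inl 0).
Qed.

Lemma Dl_app2 {E} {cE : ctx M E} (P : M -> M -> Prop) (f g : E -> M) :
  Dl (fun e : M * M => P e.1 e.2) -> Fn f -> Fn g -> Dl (fun e => P (f e) (g e)).
Proof.
move=> HP Hf Hg; apply: (Dl_sub (P := fun e x => P x (g e))) Hf.
apply: (Dl_sub (P := fun (e : E * M) y => P e.2 y) (f := fun e : E * M => g e.1)).
  by apply: (Dl_comp (h := fun e : E * M * M => (e.1.2, e.2))) HP => -[|i]; [exists (inl 0)|exists (inl 1)].
by apply: Fn_comp Hg => i; exists (inl i.+1).
Qed.

Lemma Fn_app1 {E} {cE : ctx M E} (F : M -> M) (f : E -> M) :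
  Fn F -> Fn f -> Fn (fun e => F (f e)).
Proof.
move=> HF; apply: (Fn_sub (g := fun e => F)).
by apply: (Fn_comp (h := snd)) HF => i; exists (inl 0).
Qed.

Lemma Fn_app2 {E} {cE : ctx M E} (F : M -> M -> M) (f g : E -> M) :
  Fn (fun e : M * M => F e.1 e.2) -> Fn f -> Fn g -> Fn (fun e => F (f e) (g e)).
Proof.
move=> HF Hf Hg; apply: (Fn_sub (g := fun e x => F x (g e))) Hf.
apply: (Fn_sub (g := fun (e : E * M) y => F e.2 y) (f := fun e : E * M => g e.1)).
  by apply: (Fn_comp (h := fun e : E * M * M => (e.1.2, e.2))) HF => -[|i]; [exists (inl 0)|exists (inl 1)].
by apply: Fn_comp Hg => i; exists (inl i.+1).
Qed.

Lemma Fn_add {E} {cE : ctx M E} (f g : E -> M) : Fn f -> Fn g -> Fn (fun e => f e .+ g e).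
Proof. by apply: Fn_app2; apply: Fn_pol; apply: pol_add; [exact: (pol_coord 1)|exact: (pol_coord 0)]. Qed.
Lemma Fn_mul {E} {cE : ctx M E} (f g : E -> M) : Fn f -> Fn g -> Fn (fun e => smul (f e) (g e)).
Proof. by apply: Fn_app2; apply: Fn_pol; apply: pol_mul; [exact: (pol_coord 1)|exact: (pol_coord 0)]. Qed.
Lemma Dl_eq {E} {cE : ctx M E} (f g : E -> M) : Fn f -> Fn g -> Dl (fun e => f e = g e).
Proof. by apply: Dl_app2; apply: Dl_D0; apply: (D0_eq D); [exact: (pol_coord 1)|exact: (pol_coord 0)]. Qed.
Lemma Dl_lt {E} {cE : ctx M E} (f g : E -> M) : Fn f -> Fn g -> Dl (fun e => f e ≪ g e).
Proof. by apply: Dl_app2; apply: Dl_D0; apply: (D0_lt D); [exact: (pol_coord 1)|exact: (pol_coord 0)]. Qed.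
Lemma Dl_mem {E} {cE : ctx M E} X (f : E -> M) : Fn f -> Dl (fun e => smem (f e) X).
Proof. by apply: (Dl_app1 (P := fun x => smem x X)); apply: Dl_D0; apply: D0_mem; exact: (pol_coord 0). Qed.

Lemma Dl_not {E} {cE : ctx M E} (P : E -> Prop) : Dl P -> Dl (fun e => ~ P e).
Proof. by move=> [H1 H2]; split=> //; apply: Sig_iff H1 => e; split=> [? []//|/contrapT]. Qed.
Lemma Dl_and {E} {cE : ctx M E} (P Q : E -> Prop) : Dl P -> Dl Q -> Dl (fun e => P e /\ Q e).
Proof.
move=> [P1 P2] [Q1 Q2]; split; first exact: Sig_and.
by apply: Sig_iff (Sig_or P2 Q2) => e; rewrite not_andE.
Qed.
Lemma Dl_or {E} {cE : ctx M E} (P Q : E -> Prop) : Dl P -> Dl Q -> Dl (fun e => P e \/ Q e).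
Proof.
move=> [P1 P2] [Q1 Q2]; split; first exact: Sig_or.
by apply: Sig_iff (Sig_and P2 Q2) => e; rewrite not_orE.
Qed.
Lemma Dl_imp {E} {cE : ctx M E} (P Q : E -> Prop) : Dl P -> Dl Q -> Dl (fun e => P e -> Q e).
Proof.
move=> HP HQ; apply: Dl_iff (Dl_or (Dl_not HP) HQ) => e.
by split=> [[]//|H]; case: (EM (P e)) => [/H|]; [right|left].
Qed.

Lemma Dl_all {E} {cE : ctx M E} (P : E -> M -> Prop) (f : E -> M) :
  Fn f -> Dl (fun e : E * M => P e.1 e.2) ->
  Dl (fun e => forall x, x ≪ f e -> P e x).
Proof.
move=> Hf [H1 H2].
have lift (Q : E -> M -> Prop) : Sig (fun e : E * M => Q e.1 e.2) ->
    Sig (fun e : (E * M) * M => Q e.1.1 e.2).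
  move=> HQ; apply: (Sig_comp (h := fun e : (E * M) * M => (e.1.1, e.2))) HQ.
  by case=> [|i]; [exists (inl 0)|exists (inl i.+2)].
split.
  apply: (Sig_sub (P := fun e y => forall x, x ≪ y -> P e x)) Hf.
  by apply: (Sig_all (P := fun (e : E * M) => P e.1)); [exact: (pol_coord 0)|exact: lift].
apply: (Sig_iff (P := fun e => exists x, x ≪ f e /\ ~ P e x)).
  move=> e; split=> [[x [Hx nP]] H|H]; first exact/nP/H.
  by apply: contrapT => H'; apply: H => x Hx; apply: contrapT => nP; apply: H'; exists x.
apply: Sig_ex; apply: Sig_and; last exact: H2.
apply: proj1; apply: Dl_lt; first exact: (Fn_coord 0).
by apply: Fn_comp Hf => i; exists (inl i.+1).
Qed.

Lemma Dl_ex {E} {cE : ctx M E} (P : E -> M -> Prop) (f : E -> M) :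
  Fn f -> Dl (fun e : E * M => P e.1 e.2) ->
  Dl (fun e => exists x, x ≪ f e /\ P e x).
Proof.
move=> Hf HP.
have := Dl_not (Dl_all (P := fun e x => ~ P e x) Hf (Dl_not HP)).
apply: Dl_iff => e; split=> [H|[x [Hx Px]] H]; last exact: (H x Hx).
by apply: contrapT => H'; apply: H => x Hx Px; apply: H'; exists x.
Qed.

Lemma Dl_induction (P : M -> Prop) : Dl P ->
  P (s0 M) -> (forall x, P x -> P (x .+ s1 M)) -> forall x, P x.
Proof. by case=> + _; apply: Sig_induction. Qed.

Lemma comprehension_Dl (P : M -> Prop) : Dl P -> exists X, forall x, smem x X <-> P x.
Proof.
move=> [[R [HR HP]] [S [HS HnP]]].
have [x|X HX] := D0_comprehension HM HR (D0_not D HS); last first.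
  by exists X => x; rewrite HX HP.
rewrite -HP; split=> [Px y Hy|H].
  by have : ~ P x by rewrite HnP; exists y.
by apply: contrapT; rewrite HnP => -[y /H].
Qed.

(** The hypothesis allows [P] to be Π1, as [anchor_stable] requires. If there is no least element,
    then the absence of elements below [y], a Σ1 statement by collection, is inductive in [y]. *)
Lemma least_number (P : M -> Prop) x : Sig (fun x => ~ P x) -> P x ->
  exists y, P y /\ forall z, z ≪ y -> ~ P z.
Proof.
move=> HnP; apply: contraPP => H.
suff /(_ (x .+ s1 M) x) : forall y z, z ≪ y -> ~ P z by apply; vlra.
apply: Sig_induction.
- apply: (Sig_all (P := fun e z => ~ P z)); first exact: (pol_coord 0).
  by apply: (Sig_comp (h := snd)) HnP => i; exists (inl 0).
- by move=> z Hz; exfalso; vlra.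
- move=> y IH z Hz Pz; apply: H; exists z; split=> // w Hw; apply: IH; vlra.
Qed.

(* [mu P] is [0] if [P] has no least element. *)
Definition mu (P : M -> Prop) : M :=
  if pselect (exists y, P y /\ forall z, z ≪ y -> ~ P z) is left H
  then sval (cid H) else s0 M.

Lemma fix_arg {E} {cE : ctx M E} (P : E -> M -> Prop) e :
  Dl (fun e : E * M => P e.1 e.2) -> Dl (P e).
Proof.
move=> HP; apply: (Dl_comp (h := fun x : M => (e, x))) HP.
by case=> [|i]; [exists (inl 0)|exact: fix_coords].
Qed.

Lemma muP {E} {cE : ctx M E} (P : E -> M -> Prop) e :
  Dl (fun e : E * M => P e.1 e.2) -> (exists y, P e y) ->
  P e (mu (P e)) /\ forall z, z ≪ mu (P e) -> ~ P e z.
Proof.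
move=> /(@fix_arg _ _ _ e) [_ HP] [y Py].
rewrite /mu; case: pselect => [H|[]]; first by case: cid.
exact: least_number HP Py.
Qed.

Lemma Fn_mu {E} {cE : ctx M E} (P : E -> M -> Prop) :
  Dl (fun e : E * M => P e.1 e.2) -> (forall e, exists y, P e y) ->
  Fn (fun e => mu (P e)).
Proof.
move=> HP tot; apply: (Sig_iff (P := fun e : E * M =>
   P e.1 e.2 /\ forall z, z ≪ e.2 -> ~ P e.1 z)).
  move=> [e y] /=; have [H1 H2] := muP HP (tot e); split=> [[Py Hy]|<- //].
  case: (slt_cases D HM (mu (P e)) y) => [/Hy//|[//|/H2//]].
apply: Sig_and; first by case: HP.
apply: (Sig_all (P := fun (e : E * M) z => ~ P e.1 z)); first exact: (pol_coord 0).
case: HP => _ HP; apply: (Sig_comp (h := fun e : (E * M) * M => (e.1.1, e.2))) HP.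
by case=> [|i]; [exists (inl 0)|exists (inl i.+2)].
Qed.

Lemma Fn_graph {E} {cE : ctx M E} (G : E -> M -> Prop) (f : E -> M) :
  (forall e y, f e = y <-> G e y) -> Sig (fun e : E * M => G e.1 e.2) -> Fn f.
Proof. by move=> H; apply: Sig_iff => e; rewrite H. Qed.

End Computability.

(** * Primitive recursion *)

Lemma Dl_Sig {M : structure} {E} {cE : ctx M E} (P : E -> Prop) : Dl P -> Sig P.
Proof. by case. Qed.

Ltac fn_step D HM := cbv beta; first
  [ exact: (Fn_coord D 0) | exact: (Fn_coord D 1) | exact: (Fn_coord D 2)
  | exact: (Fn_coord D 3) | exact: (Fn_coord D 4) | exact: (Fn_coord D 5)
  | exact: (Fn_coord D 6) | exact: (Fn_coord D 7)
  | exact: (Fn_const D)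
  | apply: (Fn_add D HM) | apply: (Fn_mul D HM)
  | match goal with H : _ |- Fn _ => apply: H end ].

(** The search follows the syntax of the goal and takes particular predicates and functions from the
    local context. This is why proofs below first introduce closure facts as hypotheses. *)
Ltac dl_step D HM := cbv beta; lazymatch goal with
  | |- Dl (slt ?a) => change (Dl (fun x => slt a x))
  | |- Dl (fun _ => ~ _) => apply: Dl_not
  | |- Dl (fun _ => _ /\ _) => apply: (Dl_and D HM)
  | |- Dl (fun _ => _ \/ _) => apply: (Dl_or D HM)
  | |- Dl (fun _ => @eq (dom _) _ _) => apply: (Dl_eq D HM)
  | |- Dl (fun _ => slt _ _) => apply: (Dl_lt D HM)
  | |- Dl (fun _ => smem _ _) => apply: (Dl_mem D HM)
  | |- Dl (fun _ => exists x, _) => apply: (Dl_ex D HM)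
  | |- Dl (fun _ => forall x : dom _, _) => apply: (Dl_all D HM)
  | |- Dl (fun _ => _ -> _) => apply: (Dl_imp D HM)
  | |- Dl _ => match goal with H : _ |- _ => apply: H end
  | |- Fn _ => fn_step D HM
  | |- Sig (fun _ => _ /\ _) => apply: (Sig_and D HM)
  | |- Sig (fun _ => _ \/ _) => apply: (Sig_or D)
  | |- Sig (fun _ => exists x, _) => apply: (Sig_ex D HM)
  | |- Sig _ => apply: Dl_Sig
  end.

Ltac decide_dl D HM := repeat dl_step D HM.

(** * Gödel coding of finite sets and functions defined by recursion *)

Section Recursion.
Variables (M : structure) (D : sets M).
Hypothesis HM : models M RCA0.
Local Notation "x ≪ y" := (slt x y) (at level 70).
Local Notation "x '.+' y" := (sadd x y) (at level 50, left associativity).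
Local Notation "x '.*' y" := (smul x y) (at level 40, left associativity).
Local Notation "''0'" := (s0 M).
Local Notation "''1'" := (s1 M).
Local Notation emb := (emb D HM).
Implicit Types x y z : M.

Ltac vlra := to_emb D HM; lra.
Ltac vnra := to_emb D HM; nra.
Ltac dec := decide_dl D HM.

Lemma Dl_app3 {E} {cE : ctx M E} (P : M -> M -> M -> Prop) (f g h : E -> M) :
  Dl (fun e : M * M * M => P e.1.1 e.1.2 e.2) -> Fn f -> Fn g -> Fn h ->
  Dl (fun e => P (f e) (g e) (h e)).
Proof.
move=> HP Hf Hg Hh; apply: (Dl_sub D HM (P := fun e x => P x (g e) (h e))) Hf.
apply: (Dl_sub D HM (P := fun (e : E * M) x => P e.2 x (h e.1)) (f := fun e : E * M => g e.1)); last first.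
  by apply: Fn_comp Hg => i; exists (inl i.+1).
apply: (Dl_sub D HM (P := fun (e : E * M * M) x => P e.1.2 e.2 x) (f := fun e : E * M * M => h e.1.1)); last first.
  by apply: Fn_comp Hh => i; exists (inl i.+2).
apply: (Dl_comp (P := fun e : M * M * M => P e.1.1 e.1.2 e.2)
  (h := fun e : E * M * M * M => ((e.1.1.2, e.1.2), e.2))) HP.
by case=> [|[|i]]; [exists (inl 0)|exists (inl 1)|exists (inl 2)].
Qed.

(** These are the moduli of Gödel's beta function. *)
Definition modulus (b i : M) : M := (i .+ '1) .* b .+ '1.
(* The pair [a], [b] codes the finite set of all [i] such that [1 + (i + 1) b]
   divides [a]. *)
Definition coded (a b i : M) : Prop := exists m, m ≪ a .+ '1 /\ a = modulus b i .* m.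

Lemma Dl_coded {E} {cE : ctx M E} (f g h : E -> M) : Fn f -> Fn g -> Fn h ->
  Dl (fun e => coded (f e) (g e) (h e)).
Proof.
move=> Hf Hg Hh.
by move: Hf Hg Hh; apply: (Dl_app3 (P := coded)); rewrite /coded /modulus; dec.
Qed.

(** A substitute for the factorial, which is not yet definable: each step multiplies by [n + 1]. The
    bound on [q] makes the matrix Δ1. *)
Lemma common_multiple n : exists b, '0 ≪ b /\ forall i, i ≪ n -> exists q, q ≪ b .+ '1 /\ b = (i .+ '1) .* q.
Proof.
move: n; apply: (Sig_induction HM).
- by dec.
- by exists '1; split=> [|i Hi]; [vlra|exfalso; vlra].
- move=> n [b [Hb H]]; exists (b .* (n .+ '1)); split; first by vnra.
  move=> i Hi; case: (slt_cases D HM i n) => [/H[q [_ Eq]]|[->|?]]; last by exfalso; vlra.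
    exists (q .* (n .+ '1)).
    have E : b .* (n .+ '1) = (i .+ '1) .* (q .* (n .+ '1)).
      by rewrite {1}Eq; to_emb D HM; ring.
    split=> //; rewrite E.
    by have := mulr_ge0 (emb_ge0 D HM i) (emb_ge0 D HM (q .* (n .+ '1))) => ?; vlra.
  exists b; split; last by to_emb D HM; ring.
  by to_emb D HM; nra.
Qed.


Lemma slt_ex x y : x ≪ y -> exists z, y = x .+ z .+ '1.
Proof. exact: (proj1 (@dltE (dosr_of D HM) x y)). Qed.

(* Modulo [modulus b i], the number [b] is invertible with inverse [- (i + 1)],
   and [modulus b k] is congruent to [(k - i) b], where [k - i] divides [b]. *)
Lemma modulus_coprime b n i k : (forall j, j ≪ n -> exists q, q ≪ b .+ '1 /\ b = (j .+ '1) .* q) ->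
  i ≪ n -> k ≪ n -> i <> k ->
  exists u v v', modulus b k .* u .+ modulus b i .* v = '1 .+ modulus b i .* v'.
Proof.
move=> Hb Hi Hk nik.
case: (slt_cases D HM i k) => [/slt_ex [z Ez]|[//|/slt_ex [z Ez]]].
- have [|e [_ Ee]] := Hb z; first by vlra.
  exists (e .* (i .+ '1) .* (i .+ '1)), ('1 .+ '1),
    (e .* (i .+ '1) .* (i .+ '1) .+ modulus b i).
  by apply/(@emb_inj _ D HM); rewrite /modulus; to_emb D HM; rewrite Ez Ee; ring.
- have [|e [_ Ee]] := Hb z; first by vlra.
  exists (e .* (i .+ '1) .* (i .+ '1) .* (i .+ '1) .* b),
    (modulus b i .* modulus b i .+ '1 .+ '1 .+ '1),
    (e .* (i .+ '1) .* (i .+ '1) .* (i .+ '1) .* b .+ modulus b i .+ modulus b i .+ modulus b i).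
  by apply/(@emb_inj _ D HM); rewrite /modulus; to_emb D HM; rewrite Ez Ee; ring.
Qed.

(** The equation is a Bézout identity without subtraction. A modulus dividing [a] would divide 1,
    but it exceeds 1 because [b] is positive. *)
Lemma coprime_not_divides b i a u v v' m : '0 ≪ b ->
  a .* u .+ modulus b i .* v = '1 .+ modulus b i .* v' -> a = modulus b i .* m -> False.
Proof.
rewrite /modulus => Hb E Ea; set d := (i .+ '1) .* b .+ '1 in E Ea.
have Hd : '1 ≪ d by rewrite /d; vnra.
clearbody d.
have {}E : d .* (m .* u .+ v) = '1 .+ d .* v' by rewrite -E Ea; to_emb D HM; ring.
case: (EM (m .* u .+ v ≪ v' .+ '1)) => H.
  have : emb d * (emb m * emb u + emb v) <= emb d * emb v'.
    by apply: ler_wpM2l; [exact: emb_ge0|vlra].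
  by move=> ?; vlra.
have : emb d * (emb v' + 1) <= emb d * (emb m * emb u + emb v).
  by apply: ler_wpM2l; [exact: emb_ge0|vlra].
by move=> ?; vlra.
Qed.

(** The code [a] is the product of the moduli of the members, collected in order. Non-membership is
    carried through the induction as a Bézout identity, since coprimality then has Σ1 form and
    passes to products. *)
Lemma code_exists (P : M -> Prop) n : Dl P ->
  exists a b, forall i, i ≪ n -> (P i <-> coded a b i).
Proof.
move=> HP; have [b [Hb Hdiv]] := common_multiple n.
suff [a Ha] : exists a, forall i, i ≪ n ->
    (~ (i ≪ n /\ P i) \/ exists m, a = modulus b i .* m) /\
    ((i ≪ n /\ P i) \/
      exists u v v', a .* u .+ modulus b i .* v = '1 .+ modulus b i .* v').
  exists a, b => i Hi; have [H1 H2] := Ha i Hi; split=> [Pi|[m [_ Em]]].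
    case: H1 => [[]//|[m Em]]; exists m; split=> //.
    rewrite Em /modulus; to_emb D HM.
    have := mulr_ge0 (emb_ge0 D HM ((i .+ '1) .* b)) (emb_ge0 D HM m) => ?; vlra.
  case: H2 => [[]//|[u [v [v' E]]]].
  by case: (coprime_not_divides Hb E Em).
suff : forall k, exists a, forall i, i ≪ n ->
    (~ (i ≪ k /\ P i) \/ exists m, a = modulus b i .* m) /\
    ((i ≪ k /\ P i) \/
      exists u v v', a .* u .+ modulus b i .* v = '1 .+ modulus b i .* v').
  by move=> /(_ n).
apply: (Sig_induction HM).
- apply: (Sig_ex D HM); apply: (Sig_all D HM (P := fun (e : M * M) i =>
    (~ (i ≪ e.1 /\ P i) \/ exists m, e.2 = modulus b i .* m) /\
    ((i ≪ e.1 /\ P i) \/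
      exists u v v', e.2 .* u .+ modulus b i .* v = '1 .+ modulus b i .* v'))).
    exact: pol_const.
  by have HP' := @Dl_app1 _ D HM (M * M * M)%type _ P; rewrite /modulus; dec.
- exists '1 => i Hi; split; first by left=> -[? _]; vlra.
  by right; exists '1, '0, '0; to_emb D HM; ring.
move=> k [a Ha].
case: (EM (k ≪ n /\ P k)) => [[Hk Pk]|nPk]; last first.
  exists a => i Hi; have [H1 H2] := Ha i Hi; split.
    case: H1 => [H1|]; [left|by right].
    move=> [H Pi]; apply: H1; split=> //; case: (slt_cases D HM i k) => [//|[E|?]].
      by case: nPk; rewrite -E.
    by exfalso; vlra.
  by case: H2 => [[H2 Pi]|]; [left; split=> //; vlra|right].
exists (a .* modulus b k) => i Hi; have [H1 H2] := Ha i Hi.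
have Hik : i ≪ k .+ '1 <-> i ≪ k \/ i = k.
  split=> [?|[?|->]]; [|vlra|vlra].
  by case: (slt_cases D HM i k) => [|[|?]]; [left|right|exfalso; vlra].
case: (EM (i = k)) => [->|nik].
  split; last by left; split=> //; vlra.
  by right; exists a; to_emb D HM; ring.
have {}Hik : i ≪ k .+ '1 <-> i ≪ k by rewrite Hik; split=> [[]//|]; left.
rewrite Hik; split.
  case: H1 => [|[m Em]]; [by left|right].
  by exists (m .* modulus b k); rewrite Em; to_emb D HM; ring.
case: H2 => [|[u [v [v' E]]]]; [by left|right].
have [u2 [v2 [v2' E2]]] := modulus_coprime Hdiv Hi Hk nik.
set d := modulus b i in E E2 *; set dk := modulus b k in E2 *.
clearbody d dk.
(* These coefficients result from multiplying the two Bézout identities and moving the negative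
   terms to the left. *)
exists (u .* u2), (v .+ v2 .+ d .* (v' .* v2 .+ v .* v2')),
  (v' .+ v2' .+ d .* (v' .* v2' .+ v .* v2)).
to_emb D HM.
have {}E : emb a * emb u = 1 + emb d * emb v' - emb d * emb v by lra.
have {}E2 : emb dk * emb u2 = 1 + emb d * emb v2' - emb d * emb v2 by lra.
transitivity ((emb a * emb u) * (emb dk * emb u2) +
  emb d * (emb v + emb v2 + emb d * (emb v' * emb v2 + emb v * emb v2'))); first by ring.
by rewrite E E2; ring.
Qed.

Definition npr x y : M := (x .+ y) .* (x .+ y) .+ x.

Lemma Fn_npr {E} {cE : ctx M E} (f g : E -> M) : Fn f -> Fn g ->
  Fn (fun e => npr (f e) (g e)).
Proof. by move=> Hf Hg; rewrite /npr; dec. Qed.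

(** The code lies between [(x + y)^2] and the next square, so it determines [x + y] and then [x]. *)
Lemma npr_inj x y x' y' : npr x y = npr x' y' -> x = x' /\ y = y'.
Proof.
have lt (a b a' b' : M) : a .+ b ≪ a' .+ b' -> npr a b <> npr a' b'.
  rewrite /npr => H E; to_emb D HM.
  have : (emb a + emb b + 1) * (emb a + emb b + 1) <= (emb a' + emb b') * (emb a' + emb b').
    by apply: ler_pM; lra.
  by move=> ?; lra.
move=> E; case: (slt_cases D HM (x .+ y) (x' .+ y')) => [/lt//|[S|/lt/(_ (esym E))//]].
have Ex : x = x' by move: E; rewrite /npr S => E; vlra.
by split=> //; rewrite Ex in S; vlra.
Qed.

Lemma npr_gel x y : ~ npr x y ≪ x.
Proof. by rewrite /npr; to_emb D HM; nra. Qed.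
Lemma npr_ger x y : ~ npr x y ≪ y.
Proof.
rewrite /npr => H; case: (slt_cases D HM '0 y) => [?|[E|?]]; last by vlra.
  by vnra.
by rewrite -E in H; vnra.
Qed.

Lemma zero_neq_succ x : '0 <> x .+ '1.
Proof. by move=> E; vlra. Qed.
Lemma succ_inj x y : x .+ '1 = y .+ '1 -> x = y.
Proof. by move=> E; vlra. Qed.

Section PrimitiveRecursion.
Context {E : Type} {cE : ctx M E}.
Variables (base : E -> M) (step : E -> M -> M -> M).
Hypothesis Hbase : Fn base.
Hypothesis Hstep : Fn (fun w : (E * M) * M => step w.1.1 w.1.2 w.2).

(** A coded set of argument-value pairs in which each member below [n] is justified by the base case
    or by another member. Being closed under predecessors is all that correctness needs. *)
Definition computation (e : E) (a b n : M) : Prop :=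
  forall p, p ≪ n -> coded a b p ->
    p = npr '0 (base e) \/
    exists k, k ≪ n /\ exists u, u ≪ n /\
      (p = npr (k .+ '1) (step e k u) /\ (npr k u ≪ n /\ coded a b (npr k u))).

Definition computes (e : E) (k v : M) : Prop :=
  exists a b n, computation e a b n /\ (npr k v ≪ n /\ coded a b (npr k v)).

Lemma computes_fun e k v v' : computes e k v -> computes e k v' -> v = v'.
Proof.
move=> [a [b [n [C [Hn Hv]]]]] [a' [b' [n' [C' [Hn' Hv']]]]].
(* The bounds on [v] and [v'] make the induction statement Δ1; they cost nothing because a component
   never exceeds the code of its pair. *)
suff H : forall k v, v ≪ n -> forall v', v' ≪ n' -> npr k v ≪ n -> coded a b (npr k v) ->
    npr k v' ≪ n' -> coded a' b' (npr k v') -> v = v'.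
  by apply: (H k) => //; [have := @npr_ger k v|have := @npr_ger k v']; move=> ?; vlra.
move=> {k v v' Hn Hv Hn' Hv'} k.
move: k; apply: (Dl_induction HM).
  by have H1 := @Dl_coded; have H2 := @Fn_npr; dec.
- move=> v _ v' _ Hn /(C _ Hn) Hv Hn' /(C' _ Hn') Hv'.
  case: Hv => [/npr_inj[_ ->]|[k [_ [u [_ [/npr_inj[/zero_neq_succ []]]]]]]].
  by case: Hv' => [/npr_inj[_ ->]|[k [_ [u [_ [/npr_inj[/zero_neq_succ []]]]]]]].
- move=> k IH v _ v' _ Hn /(C _ Hn) Hv Hn' /(C' _ Hn') Hv'.
  case: Hv => [/npr_inj[/esym/zero_neq_succ []]|[j [_ [u [Hu [/npr_inj[/succ_inj Ej ->] [H1 H2]]]]]]].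
  case: Hv' => [/npr_inj[/esym/zero_neq_succ []]|[j' [_ [u' [Hu' [/npr_inj[/succ_inj Ej' ->] [H1' H2']]]]]]].
  by subst j j'; rewrite (IH u Hu u' Hu').
Qed.

Lemma Sig_computes : Sig (fun w : E * M * M => computes w.1.1 w.1.2 w.2).
Proof.
have H1 := @Dl_coded; have H2 := @Fn_npr.
have Hb : Fn (fun w : E * M * M * M * M * M * M => base w.1.1.1.1.1.1).
  by apply: Fn_comp Hbase => i; exists (inl (6 + i)%N).
have Hs : Fn (fun w : E * M * M * M * M * M * M * M * M =>
    step w.1.1.1.1.1.1.1.1 w.1.2 w.2).
  apply: (Fn_comp (h := fun w : E * M * M * M * M * M * M * M * M =>
    ((w.1.1.1.1.1.1.1.1, w.1.2), w.2))) Hstep.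
  by case=> [|[|i]]; [exists (inl 0)|exists (inl 1)|exists (inl (8 + i)%N)].
by rewrite /computes /computation; dec.
Qed.

(** In the successor step the old members together with the new pair form a Δ1 set, which is coded
    afresh instead of modifying the old code. *)
Lemma computes_total e k : exists v, computes e k v.
Proof.
move: k; apply: (Sig_induction HM).
- apply: (Sig_ex D HM (P := computes e)).
  apply: (Sig_comp (h := fun w : M * M => ((e, w.1), w.2))) Sig_computes.
  by case=> [|[|i]]; [exists (inl 0)|exists (inl 1)|exact: fix_coords].
- have HP : Dl (fun p => p = npr '0 (base e)) by have H2 := @Fn_npr; dec.
  have [a [b Hab]] := code_exists (npr '0 (base e) .+ '1) HP.
  exists (base e), a, b, (npr '0 (base e) .+ '1); split; first by move=> p Hp /(Hab _ Hp); left.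
  have H : npr '0 (base e) ≪ npr '0 (base e) .+ '1 by vlra.
  by split=> //; apply/Hab.
- move=> k [v [a [b [n [C [Hn Hv]]]]]].
  have [q Eq] : exists q, q = npr (k .+ '1) (step e k v) by eexists.
  have HP : Dl (fun p => (p ≪ n /\ coded a b p) \/ p = q).
    by have H1 := @Dl_coded; have H2 := @Fn_npr; dec.
  have [a' [b' Hab]] := code_exists (n .+ q .+ '1) HP.
  exists (step e k v), a', b', (n .+ q .+ '1); split; last first.
    rewrite -Eq; have H : q ≪ n .+ q .+ '1 by vlra.
    by split=> //; apply/(Hab _ H); right.
  have old p : p ≪ n -> coded a b p -> p ≪ n .+ q .+ '1 /\ coded a' b' p.
    move=> H1 H2; have H : p ≪ n .+ q .+ '1 by vlra.
    by split=> //; apply/(Hab _ H); left.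
  move=> p Hp /(Hab _ Hp) [[H1 /(C _ H1)]|->].
    case=> [|[j [Hj [u [Hu [Ep [H3 H4]]]]]]]; first by left.
    right; exists j; split; first by vlra.
    exists u; split; first by vlra.
    by split=> //; exact: old.
  right; exists k; split; first by have := @npr_gel k v => ?; vlra.
  exists v; split; first by have := @npr_ger k v => ?; vlra.
  by split=> //; exact: old.
Qed.

(** The values are chosen outside the model. Uniqueness identifies the graph of the chosen function
    with the Σ1 relation [computes], which makes it computable in the model. *)
Theorem primitive_recursion : exists F : E -> M -> M,
  [/\ Fn (fun w : E * M => F w.1 w.2), forall e, F e '0 = base e &
      forall e k, F e (k .+ '1) = step e k (F e k)].
Proof.
have tot (e : E) : exists F : M -> M, forall k, computes e k (F k).
  by have [F HF] := choice (computes_total e); exists F.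
have [F HF] := choice tot.
have FE e k v : computes e k v -> F e k = v by move=> /(computes_fun (HF e k)).
exists F; split.
- apply: (Fn_graph (G := fun w v => computes w.1 w.2 v)) Sig_computes => -[e k] v /=.
  by split=> [<-|/FE].
- move=> e; have [a [b [n [C [Hn /(C _ Hn)]]]]] := HF e '0.
  by case=> [/npr_inj[_ ->]|[k [_ [u [_ [/npr_inj[/zero_neq_succ []]]]]]]].
- move=> e k; have [a [b [n [C [Hn /(C _ Hn)]]]]] := HF e (k .+ '1).
  case=> [/npr_inj[/esym/zero_neq_succ []]|[j [_ [u [_ [/npr_inj[/succ_inj <- ->] Hu]]]]]].
  by congr step; apply/esym/FE; exists a, b, n.
Qed.

End PrimitiveRecursion.
End Recursion.

(** * The diagonal construction *)

Section Diagonal.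
Variables (M : structure) (D : sets M).
Hypothesis HM : models M RCA0.
Local Notation "x ≪ y" := (slt x y) (at level 70).
Local Notation "x '.+' y" := (sadd x y) (at level 50, left associativity).
Local Notation "x '.*' y" := (smul x y) (at level 40, left associativity).
Local Notation "''0'" := (s0 M).
Local Notation "''1'" := (s1 M).
Local Notation "''4'" := ('1 .+ '1 .+ '1 .+ '1).
Local Notation emb := (emb D HM).
Local Notation K := (frac (dosr_of D HM)).
Implicit Types x y z n i j k m N : M.

Ltac vlra := to_emb D HM; lra.
Ltac dec := decide_dl D HM.

Definition rat (a b c : M) : K := (emb a - emb b) / (emb c + 1).

Lemma le_ex x y : ~ y ≪ x -> exists t, y = x .+ t.
Proof.
case: (slt_cases D HM x y) => [/(slt_ex D HM) [z ->] _|[->|//]].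
  by exists (z .+ '1); vlra.
by exists '0; vlra.
Qed.

(** Witnesses for a Δ1 relation can be bounded by Σ1 induction alone, in contrast to the assumption
    [bounding] below. *)
Lemma collection (P : M -> M -> Prop) n : Dl (fun e : M * M => P e.1 e.2) ->
  (forall x, x ≪ n -> exists y, P x y) ->
  exists z, forall x, x ≪ n -> exists y, y ≪ z /\ P x y.
Proof.
move=> HP H.
suff : forall t, exists z, forall x, x ≪ t -> x ≪ n -> exists y, y ≪ z /\ P x y.
  by move=> /(_ n) [z Hz]; exists z => x Hx; apply: Hz.
apply: (Sig_induction HM).
- have HP' E cE f g := @Dl_app2 M D HM E cE P f g HP.
  by apply: (Sig_ex D HM); apply: Dl_Sig; dec.
- by exists '0 => x Hx; exfalso; vlra.
- move=> t [z Hz]; case: (EM (t ≪ n)) => [/H[y Hy]|Ht]; last first.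
    exists z => x Hx Hxn; apply: Hz => //.
    by case: (slt_cases D HM x t) => [//|[E|?]]; [by rewrite E in Hxn|exfalso; vlra].
  exists (z .+ y .+ '1) => x Hx Hxn.
  case: (slt_cases D HM x t) => [/Hz/(_ Hxn) [y' [Hy' P']]|[->|?]].
  + by exists y'; split=> //; vlra.
  + by exists y; split=> //; vlra.
  + by exfalso; vlra.
Qed.

Section Construction.
Variables xa xb xc : M -> M -> M.
Hypothesis Hxa : Fn (fun e : M * M => xa e.1 e.2).
Hypothesis Hxb : Fn (fun e : M * M => xb e.1 e.2).
Hypothesis Hxc : Fn (fun e : M * M => xc e.1 e.2).

Definition xv n i : K := rat (xa n i) (xb n i) (xc n i).

Hypothesis x_cauchy : forall n a b c, 0 < rat a b c -> exists N, forall m k,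
  ~ m ≪ N -> ~ k ≪ N -> xv n m < xv n k + rat a b c.

(** Collection for the Π1 condition that [P n] holds from [N] on. This is the form in which IPP
    enters; it is discharged by [ipp_bounding]. *)
Hypothesis bounding : forall (P : M -> M -> Prop) m,
  Dl (fun e : M * M => P e.1 e.2) ->
  (forall n, n ≪ m -> exists N, forall i, ~ i ≪ N -> P n i) ->
  exists N, forall n, n ≪ m -> forall i, ~ i ≪ N -> P n i.

Variable pow : M -> M.
Hypothesis Fn_pow : Fn pow.
Hypothesis pow0 : pow '0 = '1.
Hypothesis powS : forall k, pow (k .+ '1) = '4 .* pow k.

Let Ra E cE f g := @Fn_app2 M D HM E cE xa f g Hxa.
Let Rb E cE f g := @Fn_app2 M D HM E cE xb f g Hxb.
Let Rc E cE f g := @Fn_app2 M D HM E cE xc f g Hxc.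
Let Rp E cE f := @Fn_app1 M D HM E cE pow f Fn_pow.

Lemma pow_gt k : k ≪ pow k.
Proof.
move: k; apply: (Dl_induction HM); first by dec.
  by rewrite pow0; vlra.
by move=> k IH; rewrite powS; vlra.
Qed.

(** The inequality of [one_sidedE] with denominators cleared: a comparison of products and sums in
    [M], hence Δ1. *)
Definition one_sided n j k : Prop :=
  ~ (xc n j .+ '1) .* (xc n k .+ '1) .+
      ('1 .+ '1) .* pow (n .+ '1) .* (xa n k .* (xc n j .+ '1) .+ xb n j .* (xc n k .+ '1)) ≪
    ('1 .+ '1) .* pow (n .+ '1) .* (xa n j .* (xc n k .+ '1) .+ xb n k .* (xc n j .+ '1)).
Definition near n j k : Prop := one_sided n j k /\ one_sided n k j.
(** Half of the margin in [yv_avoids]: one half absorbs the distance between [x_n] and its anchor,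
    the other remains as separation. *)
Definition radius n : K := (2 * emb (pow (n .+ '1)))^-1.

Lemma radius_gt0 n : 0 < radius n.
Proof. by rewrite invr_gt0; have := @pow_gt (n .+ '1) => ?; vlra. Qed.

Lemma one_sidedE n j k : one_sided n j k <-> xv n j <= xv n k + radius n.
Proof.
rewrite /one_sided /xv /rat /radius.
have := @pow_gt (n .+ '1).
move: (pow _) (xa n j) (xa n k) (xb n j) (xb n k) (xc n j) (xc n k) => p a a' b b' c c' H.
have {}H : 0 < emb p by vlra.
have C0 : 0 < emb c + 1 by have := emb_ge0 D HM c; lra.
have C0' : 0 < emb c' + 1 by have := emb_ge0 D HM c'; lra.
have P0 : 0 < 2 * emb p * (emb c + 1) * (emb c' + 1) by rewrite !mulr_gt0.
rewrite (nslt_emb D HM) ?(embD, embM, emb1).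
rewrite -[X in _ <-> is_true X](ler_pM2r P0).
have -> : (emb a - emb b) / (emb c + 1) * (2 * emb p * (emb c + 1) * (emb c' + 1)) =
  (emb a - emb b) * 2 * emb p * (emb c' + 1) by field; lra.
have -> : ((emb a' - emb b') / (emb c' + 1) + (2 * emb p)^-1) * (2 * emb p * (emb c + 1) * (emb c' + 1)) =
  (emb a' - emb b') * 2 * emb p * (emb c + 1) + (emb c + 1) * (emb c' + 1).
  by field; lra.
by split; lra.
Qed.

Lemma nearE n j k : near n j k <-> `|xv n j - xv n k| <= radius n.
Proof.
rewrite /near !one_sidedE ler_norml.
by split=> [[H1 H2]|/andP[H1 H2]]; [apply/andP|]; split; lra.
Qed.

Lemma Dl_near : Dl (fun e : M * M * M => near e.1.1 e.1.2 e.2).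
Proof. by rewrite /near /one_sided; dec. Qed.

Let Rn E cE f g h := @Dl_app3 M D HM E cE near f g h Dl_near.

(* The least [j] such that [x_n] does not move far away from [x_nj] between the
   stages [j] and [i]: it stabilises as [i] grows, which makes the digit chosen
   against [x_n] stabilise as well. *)
Definition anchored (e : M * M) j : Prop :=
  forall k, k ≪ e.2 .+ '1 -> ~ k ≪ j -> near e.1 j k.
Definition anchor n i : M := mu (anchored (n, i)).

Lemma Dl_anchored : Dl (fun e : M * M * M => anchored e.1 e.2).
Proof. by rewrite /anchored; dec. Qed.

(** At [j = i + 1] the condition is vacuous. *)
Lemma anchored_ex e : exists j, anchored e j.
Proof. by exists (e.2 .+ '1). Qed.

Lemma Fn_anchor : Fn (fun e : M * M => anchor e.1 e.2).
Proof.
have := Fn_mu D HM Dl_anchored anchored_ex.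
by apply: (Fn_graph (G := fun e y => mu (anchored e) = y)) => -[n i].
Qed.

Let Rj E cE f g := @Fn_app2 M D HM E cE anchor f g Fn_anchor.

(** The limit is the least [j] from which [x_n] stays near its [j]-th term forever; it exists
    because this condition is Π1 and the Cauchy property makes it satisfiable. Each smaller index is
    refuted at some stage, and [collection] bounds these stages. *)
Lemma anchor_stable n : exists j N,
  forall i, ~ i ≪ N -> anchor n i = j /\ near n j i.
Proof.
pose Q j := forall k, ~ k ≪ j -> near n j k.
have [j [Qj j_min]] : exists j, Q j /\ forall i, i ≪ j -> ~ Q i.
  (* As the denominator of [rat] is [c + 1], this tolerance is one over [2 * pow (n + 1) + 1], just
     below [radius n]. *)
  have [|N HN] := x_cauchy n (a := '1) (b := '0) (c := ('1 .+ '1) .* pow (n .+ '1)).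
    rewrite /rat; to_emb D HM; apply: divr_gt0; first by lra.
    by have := emb_ge0 D HM (pow (n .+ '1)); lra.
  apply: (@least_number M D HM Q N).
    apply: (Sig_iff (P := fun j => exists k, ~ k ≪ j /\ ~ near n j k)).
      move=> j; split=> [[k [H1 H2]] H|H]; first exact/H2/H.
      by apply: contrapT => H'; apply: H => k Hk; apply: contrapT => H2; apply: H'; exists k.
    by dec.
  move=> k Hk; apply/nearE.
  have HNN : ~ N ≪ N by vlra.
  have := HN _ _ HNN Hk; have := HN _ _ Hk HNN.
  suff : rat '1 '0 (('1 .+ '1) .* pow (n .+ '1)) <= radius n.
    by rewrite ler_norml => *; apply/andP; split; lra.
  rewrite /rat /radius ?(embD, embM, emb0, emb1) subr0 div1r.
  have := pow_gt (n .+ '1) => ?.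
  by rewrite lef_pV2 ?posrE; vlra.
have [N HN] : exists N, forall x, x ≪ j -> exists k, k ≪ N /\ (~ k ≪ x /\ ~ near n x k).
  apply: collection; first by dec.
  move=> x /j_min H; apply: contrapT => H'; apply: H => k Hk.
  by apply: contrapT => H2; apply: H'; exists k.
exists j, (N .+ j) => i Hi; split; last by apply: Qj; vlra.
have [A1 A2] := muP D HM Dl_anchored (anchored_ex (n, i)).
rewrite -/(anchor n i) in A1 A2.
case: (slt_cases D HM (anchor n i) j) => [/HN [k [Hk [H1 H2]]]|[//|/A2 []]].
  by case: H2; apply: A1 => //; vlra.
by move=> k _; apply: Qj.
Qed.

Definition scaled_above (e : M * M) w : Prop :=
  xa e.1 (anchor e.1 e.2) .* pow (e.1 .+ '1) ≪
    (w .+ '1) .* (xc e.1 (anchor e.1 e.2) .+ '1) .+ xb e.1 (anchor e.1 e.2) .* pow (e.1 .+ '1).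
(* [floor (4 ^ (n + 1) * max (0, z))] for the anchor [z] of [x_n] *)
Definition scaled n i : M := mu (scaled_above (n, i)).

Lemma Dl_scaled_above : Dl (fun e : M * M * M => scaled_above e.1 e.2).
Proof. by rewrite /scaled_above; dec. Qed.

Lemma scaled_above_ex e : exists w, scaled_above e w.
Proof.
exists (xa e.1 (anchor e.1 e.2) .* pow (e.1 .+ '1)); rewrite /scaled_above.
move: (xa _ _) (xc _ _) (xb _ _) (pow _) => a c b p.
have := mulr_ge0 (emb_ge0 D HM (a .* p)) (emb_ge0 D HM c).
have := mulr_ge0 (emb_ge0 D HM b) (emb_ge0 D HM p).
by move=> ? ?; vlra.
Qed.

Lemma Fn_scaled : Fn (fun e : M * M => scaled e.1 e.2).
Proof.
have := Fn_mu D HM Dl_scaled_above scaled_above_ex.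
by apply: (Fn_graph (G := fun e y => mu (scaled_above e) = y)) => -[n i].
Qed.

Let Rw E cE f g := @Fn_app2 M D HM E cE scaled f g Fn_scaled.

(** The alternative [scaled n i = 0] covers a negative anchor, for which the truncated floor is too
    large. *)
Lemma xv_lt_scaled n i : let z := xv n (anchor n i) in let p := emb (pow (n .+ '1)) in
  z * p < emb (scaled n i) + 1 /\ (scaled n i = '0 \/ emb (scaled n i) <= z * p).
Proof.
have [] := muP D HM Dl_scaled_above (scaled_above_ex (n, i)).
rewrite -/(scaled n i) /scaled_above /xv /rat /=.
move: (scaled n i) (xa _ _) (xb _ _) (xc _ _) (pow _) => w a b c p H1 H2.
have C0 : 0 < emb c + 1 by have := emb_ge0 D HM c; lra.
have E : (emb a - emb b) / (emb c + 1) * emb p = (emb a * emb p - emb b * emb p) / (emb c + 1).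
  by field; lra.
rewrite E; split; first by rewrite ltr_pdivrMr //; vlra.
case: (slt_cases D HM '0 w) => [/(slt_ex D HM) [v Ew]|[->|?]]; [right|by left|exfalso; vlra].
have Hv : v ≪ w by rewrite Ew; vlra.
have := H2 v Hv; rewrite ler_pdivlMr // Ew.
by move=> ?; vlra.
Qed.

(* The digit is [scaled + 2] modulo 4: a number with this digit in position
   [n + 1] has distance at least [4 ^ - (n + 1)] from the anchor. *)
Definition is_digit (e : M * M) d : Prop :=
  exists k, k ≪ scaled e.1 e.2 .+ '1 .+ '1 .+ '1 /\ '4 .* k .+ d = scaled e.1 e.2 .+ '1 .+ '1.
Definition digit n i : M := mu (is_digit (n, i)).

Lemma Dl_is_digit : Dl (fun e : M * M * M => is_digit e.1 e.2).
Proof. by rewrite /is_digit; dec. Qed.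

Lemma is_digit_ex e : exists d, is_digit e d.
Proof. by exists (scaled e.1 e.2 .+ '1 .+ '1), '0; split; vlra. Qed.

Lemma Fn_digit : Fn (fun e : M * M => digit e.1 e.2).
Proof.
have := Fn_mu D HM Dl_is_digit is_digit_ex.
by apply: (Fn_graph (G := fun e y => mu (is_digit e) = y)) => -[n i].
Qed.

Let Rd E cE f g := @Fn_app2 M D HM E cE digit f g Fn_digit.

Lemma digitP n i : digit n i ≪ '4 /\ exists k, '4 .* k .+ digit n i = scaled n i .+ '1 .+ '1.
Proof.
have [] := muP D HM Dl_is_digit (is_digit_ex (n, i)).
rewrite -/(digit n i) /is_digit /= => -[k [Hk E]] H; split; last by exists k.
(* A digit of at least 4 could be lowered by 4 while the quotient grows by 1, against minimality. *)
apply: contrapT => /le_ex [t Et]; apply: (H t); first by rewrite Et; vlra.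
by exists (k .+ '1); rewrite Et in E; split; vlra.
Qed.

(** Stability is expressed by consecutive stages, since the resulting relation is Δ1 and does not
    mention the limit digit; this is the format that [bounding] accepts. *)
Lemma digit_stable n : exists N, forall i, ~ i ≪ N -> digit n (i .+ '1) = digit n i.
Proof.
have [j [N HN]] := anchor_stable n; exists N => i Hi.
have Hi' : ~ i .+ '1 ≪ N by vlra.
have [Ej _] := HN _ Hi; have [Ej' _] := HN _ Hi'.
have E : scaled n (i .+ '1) = scaled n i by rewrite /scaled /scaled_above /= Ej Ej'.
by rewrite /digit /is_digit /= E.
Qed.

Lemma digits_stable m : exists N, forall n, n ≪ m -> forall i, ~ i ≪ N -> digit n i = digit n N.
Proof.
have [|n _|N HN] := bounding (P := fun n i => digit n (i .+ '1) = digit n i) (m := m); first by dec.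
  exact: digit_stable.
exists N => n Hn i /le_ex [t ->]; move: t; apply: (Dl_induction HM); first by dec.
  by rewrite (_ : N .+ '0 = N) //; vlra.
move=> t IH; have Ht : ~ N .+ t ≪ N by vlra.
rewrite -IH -(HN n Hn (N .+ t) Ht); congr digit; vlra.
Qed.

(** * The approximations to the new real *)

Variable Y : M -> M -> M.
Hypothesis Fn_Y : Fn (fun e : M * M => Y e.1 e.2).
Hypothesis Y0 : forall i, Y i '0 = '0.
Hypothesis YS : forall i n, Y i (n .+ '1) = '4 .* Y i n .+ digit n i.

Let Ry E cE f g := @Fn_app2 M D HM E cE Y f g Fn_Y.

Lemma pow_gt0 k : 0 < emb (pow k).
Proof. by have := @pow_gt k => ?; vlra. Qed.

Definition yv i : K := emb (Y i i) / emb (pow i).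

(** Appending a digit below 4 subdivides the current interval of length [4^-n] and stays inside
    it. *)
Lemma Y_nested i n n' : ~ n' ≪ n ->
  emb (Y i n) / emb (pow n) <= emb (Y i n') / emb (pow n') /\
  (emb (Y i n') + 1) / emb (pow n') <= (emb (Y i n) + 1) / emb (pow n).
Proof.
move=> /le_ex [t ->]; rewrite !ler_pdivrMr ?pow_gt0 // ![_ / _ * _]mulrAC !ler_pdivlMr ?pow_gt0 //.
(* Clearing denominators turns the claim into a Δ1 statement about [M], so that induction on [t]
   applies. *)
suff [H1 H2] : ~ Y i (n .+ t) .* pow n ≪ Y i n .* pow (n .+ t) /\
    ~ (Y i n .+ '1) .* pow (n .+ t) ≪ (Y i (n .+ t) .+ '1) .* pow n by split; vlra.
move: t; apply: (Dl_induction HM); first by dec.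
  by rewrite (_ : n .+ '0 = n); [split|]; vlra.
move=> t [IH1 IH2].
rewrite (_ : n .+ (t .+ '1) = n .+ t .+ '1); last by vlra.
rewrite YS powS; have [Hd _] := digitP (n .+ t) i.
move: (Y i _) (Y i n) (pow _) (pow n) (digit _ _) => y' y p' p d in IH1 IH2 Hd *.
have := mulr_ge0 (emb_ge0 D HM d) (emb_ge0 D HM p).
have : emb d * emb p <= 3 * emb p by apply: ler_wpM2r; [exact: emb_ge0|vlra].
by move=> ? ?; split; vlra.
Qed.

Lemma yv_nested i n : ~ i ≪ n ->
  emb (Y i n) / emb (pow n) <= yv i <= (emb (Y i n) + 1) / emb (pow n).
Proof.
move=> /Y_nested -/(_ i) [H1 H2]; rewrite H1 /=; apply: le_trans H2.
by rewrite ler_pM2r ?invr_gt0 ?pow_gt0 //; lra.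
Qed.

(** In units of [4^-(n+1)] the anchor lies in the cell from [w] to [w + 1], and [y] in a cell
    starting at a number congruent to [w + 2] modulo 4. The nearest such cells start at [w + 2] and
    [w - 2], so one full cell lies between on either side; hence base 4 and offset 2. If the floor
    was truncated, then [w = 0] and there is no candidate below. *)
Lemma yv_avoids n i : n ≪ i ->
  yv i + (emb (pow (n .+ '1)))^-1 <= xv n (anchor n i) \/
  xv n (anchor n i) + (emb (pow (n .+ '1)))^-1 <= yv i.
Proof.
move=> Hi; have /yv_nested : ~ i ≪ n .+ '1 by vlra.
have P0 := pow_gt0 (n .+ '1).
rewrite ler_pdivrMr // ler_pdivlMr // => /andP[].
have [_ [k]] := digitP n i; have := xv_lt_scaled n i; rewrite YS /=.
rewrite -(ler_pM2r P0 (yv i + _)) -(ler_pM2r P0 (xv n (anchor n i) + _)).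
rewrite ![(_ + _^-1) * _]mulrDl mulVf ?gt_eqF //.
move: (xv _ _ * _) (yv i * _) (scaled n i) (digit n i) (Y i n) => z y w d u [H1 H2] E H3 H4.
case: (EM (u ≪ k)) => Hu; [left|right]; last by vlra.
case: H2 => [Ew|H2]; last by vlra.
by exfalso; rewrite Ew in E; vlra.
Qed.

(** The anchor is two radii away from [y], and [x_n] is eventually within one radius of the
    anchor. *)
Lemma yv_apart n : exists N, forall i, ~ i ≪ N ->
  yv i + radius n <= xv n i \/ xv n i + radius n <= yv i.
Proof.
have R2 : (emb (pow (n .+ '1)))^-1 = radius n + radius n.
  by rewrite /radius; have := pow_gt0 (n .+ '1) => ?; field; lra.
have [j [N HN]] := anchor_stable n; exists (N .+ n .+ '1) => i Hi.
have [|Ej /nearE] := HN i; first by vlra.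
have : n ≪ i by vlra.
move/yv_avoids; rewrite Ej R2 ler_norml => {Ej}.
by move=> [H|H] /andP[H1 H2]; [left|right]; lra.
Qed.

Lemma Y_stable m : exists N, forall i, ~ i ≪ N -> Y i m = Y N m.
Proof.
have [N HN] := digits_stable m; exists N => i Hi.
suff /(_ m) : forall n, ~ m ≪ n -> Y i n = Y N n by apply; vlra.
apply: (Dl_induction HM); first by dec.
  by rewrite !Y0.
move=> n IH Hn; rewrite !YS IH; last by vlra.
by rewrite (HN n) //; vlra.
Qed.

Lemma yv_cauchy a b c : 0 < rat a b c -> exists N, forall i k,
  ~ i ≪ N -> ~ k ≪ N -> yv i < yv k + rat a b c.
Proof.
(* [c + 1] digits suffice: a positive rational with denominator [c + 1] is at least [1 / (c + 1)],
   which exceeds [4^-(c+1)]. *)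
move=> abc; have [N HN] := Y_stable (c .+ '1).
exists (N .+ c .+ '1) => i k Hi Hk.
have /andP[_ H1] : emb (Y i (c .+ '1)) / emb (pow (c .+ '1)) <= yv i <= (emb (Y i (c .+ '1)) + 1) / emb (pow (c .+ '1)).
  by apply: yv_nested; vlra.
have /andP[H2 _] : emb (Y k (c .+ '1)) / emb (pow (c .+ '1)) <= yv k <= (emb (Y k (c .+ '1)) + 1) / emb (pow (c .+ '1)).
  by apply: yv_nested; vlra.
have Ei : Y i (c .+ '1) = Y N (c .+ '1) by apply: HN; vlra.
have Ek : Y k (c .+ '1) = Y N (c .+ '1) by apply: HN; vlra.
rewrite Ei in H1; rewrite Ek in H2.
have C0 : 0 < emb c + 1 by have := emb_ge0 D HM c; lra.
have ab : 1 <= emb a - emb b.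
  move: abc; rewrite /rat ltr_pdivlMr // mul0r.
  case: (slt_cases D HM b a) => [?|[->|?]]; vlra.
have H3 : (emb c + 1)^-1 <= rat a b c by rewrite /rat ler_pdivlMr // mulVf ?gt_eqF.
have H4 : (emb (pow (c .+ '1)))^-1 < (emb c + 1)^-1.
  by rewrite ltf_pV2 ?posrE ?pow_gt0 //; have := @pow_gt (c .+ '1) => ?; vlra.
move: H1; rewrite mulrDl mul1r => H1; lra.
Qed.

End Construction.
End Diagonal.

(** * From the formal statement to the model *)

Definition upd {A : Type} (f : nat -> A) (x : nat) (a : A) (i : nat) : A :=
  if Nat.eqb i x then a else f i.

Section NamedQuantifiers.
Variable M : structure.
Implicit Types (rho : nat -> M) (sigma : nat -> sets M).

Lemma sat_imp rho sigma p q :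
  sat rho sigma (Imp p q) <-> (sat rho sigma p -> sat rho sigma q).
Proof. by []. Qed.

(** Binding by name amounts to updating the assignment at that name, since [abstract] sends it to
    index 0 and shifts all others. *)
Lemma sat_forallN rho sigma x xs p :
  sat rho sigma (forallN (x :: xs) p) <-> forall d, sat (upd rho x d) sigma (forallN xs p).
Proof.
have E d : sat (scons d rho) sigma (substN (fun i => Var (abstract x i)) (forallN xs p)) <->
    sat (upd rho x d) sigma (forallN xs p).
  by rewrite sat_substN; apply: sat_ext => // i /=; rewrite /abstract /upd; case: Nat.eqb.
by split=> H d; apply/E; exact: H.
Qed.

Lemma sat_existsN rho sigma x xs p :
  sat rho sigma (existsN (x :: xs) p) <-> exists d, sat (upd rho x d) sigma (existsN xs p).
Proof.
have E d : sat (scons d rho) sigma (substN (fun i => Var (abstract x i)) (existsN xs p)) <->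
    sat (upd rho x d) sigma (existsN xs p).
  by rewrite sat_substN; apply: sat_ext => // i /=; rewrite /abstract /upd; case: Nat.eqb.
by rewrite [existsN _ _]/(ExN _) sat_exN; split=> -[d /E H]; exists d => //; exact/E.
Qed.

Lemma sat_forallN1 rho sigma x p :
  sat rho sigma (forallN [:: x] p) <-> forall d, sat (upd rho x d) sigma p.
Proof. exact: sat_forallN. Qed.

Lemma sat_existsN1 rho sigma x p :
  sat rho sigma (existsN [:: x] p) <-> exists d, sat (upd rho x d) sigma p.
Proof. exact: sat_existsN. Qed.

Lemma sat_forallS rho sigma X p :
  sat rho sigma (forallS X p) <-> forall D, sat rho (upd sigma X D) p.
Proof.
have E D : sat rho (scons D sigma) (substS (abstract X) p) <-> sat rho (upd sigma X D) p.
  by rewrite sat_substS; apply: sat_ext => // i /=; rewrite /abstract /upd; case: Nat.eqb.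
by split=> H d; apply/E; exact: H.
Qed.

Lemma sat_existsS rho sigma X p :
  sat rho sigma (existsS X p) <-> exists D, sat rho (upd sigma X D) p.
Proof.
have E D : sat rho (scons D sigma) (substS (abstract X) p) <-> sat rho (upd sigma X D) p.
  by rewrite sat_substS; apply: sat_ext => // i /=; rewrite /abstract /upd; case: Nat.eqb.
by rewrite [existsS _ _]/(ExS _) sat_exS; split=> -[d /E H]; exists d => //; exact/E.
Qed.

End NamedQuantifiers.

Lemma iff_all {A : Type} (P Q : A -> Prop) :
  (forall x, P x <-> Q x) -> (forall x, P x) <-> (forall x, Q x).
Proof. by move=> H; split=> HP x; apply/H. Qed.
Lemma iff_ex {A : Type} (P Q : A -> Prop) :
  (forall x, P x <-> Q x) -> (exists x, P x) <-> (exists x, Q x).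
Proof. by move=> H; split=> -[x /H Hx]; exists x. Qed.
Lemma iff_imp (P P' Q Q' : Prop) : (P <-> P') -> (Q <-> Q') -> (P -> Q) <-> (P' -> Q').
Proof. by move=> -> ->. Qed.

Section Translation.
Variables (M : structure) (D : sets M).
Hypothesis HM : models M RCA0.
Local Notation "x ≪ y" := (slt x y) (at level 70).
Local Notation "x '.+' y" := (sadd x y) (at level 50, left associativity).
Local Notation "x '.*' y" := (smul x y) (at level 40, left associativity).
Local Notation "''0'" := (s0 M).
Local Notation "''1'" := (s1 M).
Local Notation emb := (emb D HM).
Local Notation rat := (rat D HM).
Implicit Types x y z n i j k m N : M.
Implicit Types (rho : nat -> M) (sigma : nat -> sets M).

Ltac vlra := to_emb D HM; lra.
Ltac dec := decide_dl D HM.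

Lemma sat_le rho sigma s t : sat rho sigma (LessEq s t) <-> ~ eval rho t ≪ eval rho s.
Proof.
rewrite sat_or /=; case: (slt_cases D HM (eval rho s) (eval rho t)) => [H|[->|H]].
- by split=> // _; [vlra|left].
- by split=> // _; [vlra|right].
- by split=> // -[?|E]; [vlra|rewrite E; vlra].
Qed.

Lemma graph_exists (f : M -> M) : Fn f ->
  exists X, forall p, smem p X <-> exists i, p = npr i (f i).
Proof.
move=> Hf; have Hf' E cE g := @Fn_app1 M D HM E cE f g Hf.
have Hn := @Fn_npr M D HM.
(* A pair is at least as large as its first component, so the search for [i] can be bounded by
   [p]. *)
have HP : Dl (fun p => exists i, i ≪ p .+ '1 /\ p = npr i (f i)) by dec.
have [X HX] := comprehension_Dl D HM HP.
exists X => p; rewrite HX; split=> [[i [_ ->]]|[i Ei]]; first by exists i.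
by exists i; split=> //; have := @npr_gel M D HM i (f i); rewrite -Ei => ?; vlra.
Qed.

Lemma ipp_colour (c : M -> M) N :
  (forall rho sigma, sat rho sigma IPP) -> Fn c -> (forall i, ~ N ≪ c i) ->
  exists n, forall k, exists i, ~ i ≪ k /\ c i = n.
Proof.
move=> ipp Hc cN; have [C HC] := graph_exists Hc.
have := ipp (fun _ => N) (fun _ => C).
rewrite /IPP => /sat_forallN1/(_ N) /sat_forallS/(_ C) /sat_imp H.
have /H /sat_existsN1 [n /sat_and [_ /sat_forallN1 Hn]] :
    sat (upd (fun _ => N) vN N) (upd (fun _ => C) sC C) (is_colouring sC vN).
  apply/sat_and; split.
    apply/sat_forallN1 => p; apply/sat_imp => /HC [i Ei].
    apply/sat_existsN; exists i; apply/sat_existsN1; exists (c i).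
    by apply/sat_and; split=> //; apply/sat_le; exact: cN.
  apply/sat_forallN1 => i; apply/sat_existsN1; exists (c i); apply/sat_and; split.
    by apply/HC; exists i.
  by apply/sat_forallN1 => w; apply/sat_imp => /HC [j /(npr_inj D HM) [Ei Ew]]; exact: etrans Ew (congr1 c (esym Ei)).
exists n => k; have /sat_existsN1 [i /sat_and [/sat_le Hi /HC [j /(npr_inj D HM) [Ei En]]]] := Hn k.
have {}Ei : i = j := Ei; have {}En : n = c j := En.
by exists i; split=> //; rewrite Ei En.
Qed.

(* If there is no such [N], colour [N] with an [n] below [m] for which [P n]
   fails at some stage after [N]. *)
Lemma ipp_bounding (P : M -> M -> Prop) m :
  (forall rho sigma, sat rho sigma IPP) ->
  Dl (fun e : M * M => P e.1 e.2) ->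
  (forall n, n ≪ m -> exists N, forall i, ~ i ≪ N -> P n i) ->
  exists N, forall n, n ≪ m -> forall i, ~ i ≪ N -> P n i.
Proof.
move=> ipp HP H; apply: contrapT => nH.
have HP' E cE f g := @Dl_app2 M D HM E cE P f g HP.
pose lateP N i := ~ i ≪ N /\ exists n, n ≪ m /\ ~ P n i.
have late_ex N : exists i, lateP N i.
  apply: contrapT => H'; apply: nH; exists N => n Hn i Hi; apply: contrapT => nP.
  by apply: H'; exists i; split=> //; exists n.
have late_dl : Dl (fun e : M * M => lateP e.1 e.2) by rewrite /lateP; dec.
pose late N := mu (lateP N).
have Hlate : Fn late by exact: (Fn_mu D HM late_dl late_ex).
have Hlate' E cE f := @Fn_app1 M D HM E cE late f Hlate.
have lateE N : lateP N (late N) by have [] := muP D HM late_dl (late_ex N).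
pose colourP N n := n ≪ m /\ ~ P n (late N).
have colour_ex N : exists n, colourP N n by have [_] := lateE N.
have colour_dl : Dl (fun e : M * M => colourP e.1 e.2) by rewrite /colourP; dec.
pose colour N := mu (colourP N).
have Hcolour : Fn colour by exact: (Fn_mu D HM colour_dl colour_ex).
have colourE N : colourP N (colour N) by have [] := muP D HM colour_dl (colour_ex N).
have [|n Hn] := ipp_colour (c := colour) (N := m) ipp Hcolour.
  by move=> i; have [? _] := colourE i; vlra.
have [i0 [_ E0]] := Hn '0; have [nm _] := colourE i0; rewrite E0 in nm.
have [N HN] := H n nm; have [i [Hi Ei]] := Hn N.
have [_ nP] := colourE i; rewrite Ei in nP; apply: nP; apply: HN.
have [Hl _] := lateE i; vlra.
Qed.


Lemma slt_lt x y : x ≪ y <-> emb x < emb y.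
Proof.
split=> [?|H]; first by vlra.
by apply: contrapT => /(nslt_emb D HM); lra.
Qed.

Definition fval rho (x : fraction) : frac (dosr_of D HM) :=
  (emb (eval rho (Defs.pos x)) - emb (eval rho (neg x))) / emb (eval rho (den x)).

Lemma sat_qle rho sigma (x y : fraction) :
  0 < emb (eval rho (den x)) -> 0 < emb (eval rho (den y)) ->
  sat rho sigma (qle x y) <-> fval rho x <= fval rho y.
Proof.
move=> Hx Hy; apply: iff_trans (sat_le _ _ _ _) _.
rewrite /fval ler_pdivrMr // mulrAC ler_pdivlMr // (nslt_emb D HM) /= !embD !embM.
by split; lra.
Qed.

Lemma sat_qlt rho sigma (x y : fraction) :
  0 < emb (eval rho (den x)) -> 0 < emb (eval rho (den y)) ->
  sat rho sigma (qlt x y) <-> fval rho x < fval rho y.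
Proof.
move=> Hx Hy; rewrite /fval ltr_pdivrMr // mulrAC ltr_pdivlMr //.
by rewrite /qlt /= slt_lt !embD !embM; split; lra.
Qed.

Lemma fval_qadd rho (x y : fraction) :
  0 < emb (eval rho (den x)) -> 0 < emb (eval rho (den y)) ->
  fval rho (qadd x y) = fval rho x + fval rho y.
Proof. by move=> Hx Hy; rewrite /fval /= !embD !embM; field; lra. Qed.

Lemma den_value_gt0 rho (q : qvar) : 0 < emb (eval rho (den q)).
Proof. by rewrite /= !(embD, emb1); have := emb_ge0 D HM (rho (qc q)); lra. Qed.

Lemma den_qadd_gt0 rho (x y : fraction) :
  0 < emb (eval rho (den x)) -> 0 < emb (eval rho (den y)) ->
  0 < emb (eval rho (den (qadd x y))).
Proof. by move=> Hx Hy; rewrite /= !embM mulr_gt0. Qed.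

Lemma fval_value rho (q : qvar) :
  fval rho q = rat (rho (qa q)) (rho (qb q)) (rho (qc q)).
Proof. by rewrite /fval /rat /= !(embD, emb1). Qed.

Lemma sat_qle_add rho sigma (q r e : qvar) :
  sat rho sigma (qle q (qadd r e)) <->
  rat (rho (qa q)) (rho (qb q)) (rho (qc q)) <=
  rat (rho (qa r)) (rho (qb r)) (rho (qc r)) + rat (rho (qa e)) (rho (qb e)) (rho (qc e)).
Proof.
have H := den_value_gt0 rho.
by rewrite sat_qle ?den_qadd_gt0 // fval_qadd // !fval_value.
Qed.

Lemma sat_qlt_add rho sigma (q r e : qvar) :
  sat rho sigma (qlt q (qadd r e)) <->
  rat (rho (qa q)) (rho (qb q)) (rho (qc q)) <
  rat (rho (qa r)) (rho (qb r)) (rho (qc r)) + rat (rho (qa e)) (rho (qb e)) (rho (qc e)).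
Proof.
have H := den_value_gt0 rho.
by rewrite sat_qlt ?den_qadd_gt0 // fval_qadd // !fval_value.
Qed.

Lemma sat_qlt0 rho sigma (e : qvar) :
  sat rho sigma (qlt qzero e) <-> 0 < rat (rho (qa e)) (rho (qb e)) (rho (qc e)).
Proof.
have H := den_value_gt0 rho.
rewrite sat_qlt // ?fval_value /= ?emb1 ?ltr01 //.
by rewrite /fval /= emb0 subrr mul0r.
Qed.

Lemma sat_forallQ rho sigma q p :
  sat rho sigma (forallQ q p) <->
  forall a b c, sat (upd (upd (upd rho (qa q) a) (qb q) b) (qc q) c) sigma p.
Proof.
rewrite /forallQ sat_forallN; apply: iff_all => a.
by rewrite sat_forallN; apply: iff_all => b; rewrite sat_forallN1.
Qed.

Lemma sat_existsQ rho sigma q p :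
  sat rho sigma (existsQ q p) <->
  exists a b c, sat (upd (upd (upd rho (qa q) a) (qb q) b) (qc q) c) sigma p.
Proof.
rewrite /existsQ sat_existsN; apply: iff_ex => a.
by rewrite sat_existsN; apply: iff_ex => b; rewrite sat_existsN1.
Qed.

(* The terms of a sequence, read as a relation between indices and the three
   components of a rational. *)
Definition entries rho sigma (x : Defs.sequence) (R : M -> M -> M -> M -> Prop) : Prop :=
  forall rho', rho' vn = rho vn -> forall (i : nat) q,
    sat rho' sigma (entry x i q) <-> R (rho' i) (rho' (qa q)) (rho' (qb q)) (rho' (qc q)).

(** The names bound inside [cauchy] all differ from [vn], so [HR] remains applicable after every
    update of the assignment. *)
Lemma sat_cauchy rho sigma (x : Defs.sequence) R : entries rho sigma x R ->
  sat rho sigma (cauchy x) <->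
  forall a b c, 0 < rat a b c -> exists N, forall m k, ~ m ≪ N /\ ~ k ≪ N ->
    forall a1 b1 c1 a2 b2 c2, R m a1 b1 c1 /\ R k a2 b2 c2 ->
    rat a1 b1 c1 < rat a2 b2 c2 + rat a b c /\ rat a2 b2 c2 < rat a1 b1 c1 + rat a b c.
Proof.
move=> HR; rewrite /cauchy sat_forallQ; apply: iff_all => a; apply: iff_all => b; apply: iff_all => c.
rewrite sat_imp; apply: iff_imp; first exact: sat_qlt0.
rewrite sat_existsN1; apply: iff_ex => N.
rewrite sat_forallN; apply: iff_all => m; rewrite sat_forallN1; apply: iff_all => k.
rewrite sat_imp; apply: iff_imp; first by rewrite sat_and !sat_le.
rewrite sat_forallQ; apply: iff_all => a1; apply: iff_all => b1; apply: iff_all => c1.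
rewrite sat_forallQ; apply: iff_all => a2; apply: iff_all => b2; apply: iff_all => c2.
rewrite sat_imp; apply: iff_imp; first by rewrite sat_and !HR.
by rewrite /qclose sat_and !sat_qlt_add.
Qed.

Lemma sat_real_le rho sigma (x y : Defs.sequence) R S : entries rho sigma x R -> entries rho sigma y S ->
  sat rho sigma (real_le x y) <->
  forall a b c, 0 < rat a b c -> exists N, forall k, ~ k ≪ N ->
    forall a1 b1 c1 a2 b2 c2, R k a1 b1 c1 /\ S k a2 b2 c2 ->
    rat a1 b1 c1 <= rat a2 b2 c2 + rat a b c.
Proof.
move=> HR HS; rewrite /real_le sat_forallQ; apply: iff_all => a; apply: iff_all => b; apply: iff_all => c.
rewrite sat_imp; apply: iff_imp; first exact: sat_qlt0.
rewrite sat_existsN1; apply: iff_ex => N.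
rewrite sat_forallN1; apply: iff_all => k.
rewrite sat_imp; apply: iff_imp; first by rewrite sat_le.
rewrite sat_forallQ; apply: iff_all => a1; apply: iff_all => b1; apply: iff_all => c1.
rewrite sat_forallQ; apply: iff_all => a2; apply: iff_all => b2; apply: iff_all => c2.
rewrite sat_imp; apply: iff_imp; first by rewrite sat_and HR // HS.
by rewrite sat_qle_add.
Qed.

Definition row (X : sets M) n i a b c : Prop := smem (npr (npr n i) (npr (npr a b) c)) X.
Definition whole (Y : sets M) i a b c : Prop := smem (npr i (npr (npr a b) c)) Y.

Lemma entries_row rho sigma X : entries rho sigma (Row X vn) (row (sigma X) (rho vn)).
Proof. by move=> rho' <- i q. Qed.

Lemma entries_whole rho sigma Y : entries rho sigma (Whole Y) (whole (sigma Y)).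
Proof. by move=> rho' _ i q. Qed.

(** The unique value at each pair of indices is decoded into its three components. Each component is
    computable, as its graph arises from membership in the set by quantifying over the other two. *)
Lemma double_sequence_functions rho sigma X :
  sat rho sigma (is_double_sequence X) -> exists xa xb xc : M -> M -> M,
  [/\ forall n i a b c, row (sigma X) n i a b c <->
        [/\ xa n i = a, xb n i = b & xc n i = c],
      Fn (fun e : M * M => xa e.1 e.2), Fn (fun e : M * M => xb e.1 e.2) &
      Fn (fun e : M * M => xc e.1 e.2)].
Proof.
move=> /sat_and [/sat_forallN1 Hpair /sat_forallN Huniq].
have tot (e : M * M) : exists t : M * M * M, forall a b c,
    row (sigma X) e.1 e.2 a b c <-> t = (a, b, c).
  have /sat_forallN1/(_ e.2)/sat_existsN1 [u /sat_and [Hu /sat_forallN1 Hw]] := Huniq e.1.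
  have {}Hu : smem (npr (npr e.1 e.2) u) (sigma X) := Hu.
  have {}Hw w : smem (npr (npr e.1 e.2) w) (sigma X) -> w = u := Hw w.
  have := Hpair (npr (npr e.1 e.2) u); rewrite sat_imp => /(_ Hu).
  move=> /sat_existsN [n /sat_existsN1 [i]].
  move=> /sat_existsQ [a [b [c Hc]]].
  have {}Hc : npr (npr e.1 e.2) u = npr (npr n i) (npr (npr a b) c) := Hc.
  have [_ Eu] := npr_inj D HM Hc.
  exists (a, b, c) => a' b' c'; split=> [/Hw|[<- <- <-]]; last by rewrite /row -Eu.
  by rewrite Eu => /(npr_inj D HM) [/(npr_inj D HM) [-> ->] ->].
have [t Ht] := choice tot.
have Hn := @Fn_npr M D HM.
have Hrow (e : M * M) a b c : row (sigma X) e.1 e.2 a b c <-> t e = (a, b, c) by exact: Ht.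
exists (fun n i => (t (n, i)).1.1), (fun n i => (t (n, i)).1.2), (fun n i => (t (n, i)).2); split.
- move=> n i a b c; rewrite (Hrow (n, i)); case: (t (n, i)) => [[a' b'] c'] /=.
  by split=> [[-> -> ->]|[-> -> ->]].
- apply: (Fn_graph (G := fun e y => exists b c, row (sigma X) e.1 e.2 y b c)).
    move=> [n i] y; split=> [<-|[b [c /Hrow ->]]//].
    by exists (t (n, i)).1.2, (t (n, i)).2; apply/Hrow; case: (t _) => [[]].
  by rewrite /row; dec.
- apply: (Fn_graph (G := fun e y => exists a c, row (sigma X) e.1 e.2 a y c)).
    move=> [n i] y; split=> [<-|[a [c /Hrow ->]]//].
    by exists (t (n, i)).1.1, (t (n, i)).2; apply/Hrow; case: (t _) => [[]].
  by rewrite /row; dec.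
- apply: (Fn_graph (G := fun e y => exists a b, row (sigma X) e.1 e.2 a b y)).
    move=> [n i] y; split=> [<-|[a [b /Hrow ->]]//].
    by exists (t (n, i)).1.1, (t (n, i)).1.2; apply/Hrow; case: (t _) => [[]].
  by rewrite /row; dec.
Qed.

Lemma pow_exists : exists pow : M -> M,
  [/\ Fn pow, pow '0 = '1 & forall k, pow (k .+ '1) = ('1 .+ '1 .+ '1 .+ '1) .* pow k].
Proof.
have [F [HF F0 FS]] := @primitive_recursion M D HM M _ (fun _ => '1)
  (fun _ _ u => ('1 .+ '1 .+ '1 .+ '1) .* u) ltac:(by dec) ltac:(by dec).
exists (F '0); split; [|exact: F0|exact: FS].
have HF' E cE f g := @Fn_app2 M D HM E cE F f g HF.
by dec.
Qed.

Lemma close_not_apart (e r x y : frac (dosr_of D HM)) : e < r ->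
  y + r <= x \/ x + r <= y -> y <= x + e -> x <= y + e -> False.
Proof. by move=> ? [] *; lra. Qed.

Lemma uncountable rho sigma :
  (forall rho sigma, sat rho sigma IPP) -> sat rho sigma reals_uncountable.
Proof.
move=> ipp; apply/sat_forallS => X; apply/sat_imp => /sat_and [/double_sequence_functions].
move=> [xa [xb [xc [rowE Hxa Hxb Hxc]]]] /sat_forallN1 Hcauchy.
rewrite [upd _ _ _ _]/= in rowE.
have x_cauchy n a b c : 0 < rat a b c -> exists N, forall m k, ~ m ≪ N -> ~ k ≪ N ->
    xv D HM xa xb xc n m < xv D HM xa xb xc n k + rat a b c.
  move=> abc; have /(sat_cauchy (@entries_row _ _ _)) H := Hcauchy n.
  have [N HN] := H a b c abc; exists N => m k Hm Hk.
  have [] := HN m k (conj Hm Hk) (xa n m) (xb n m) (xc n m) (xa n k) (xb n k) (xc n k); last by [].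
  by split; apply/rowE.
have bounding (P : M -> M -> Prop) m := @ipp_bounding P m ipp.
have [pow [Fn_pow pow0 powS]] := pow_exists.
have Fd := Fn_digit D HM Hxa Hxb Hxc Fn_pow.
have Hd E cE f g := @Fn_app2 M D HM E cE _ f g Fd.
have base_fn : Fn (fun _ : M => '0) by dec.
have step_fn : Fn (fun w : M * M * M =>
    ('1 .+ '1 .+ '1 .+ '1) .* w.2 .+ digit xa xb xc pow w.1.2 w.1.1) by dec.
have [Y [Fn_Y Y0 YS]] := primitive_recursion D HM
  (step := fun i n u => ('1 .+ '1 .+ '1 .+ '1) .* u .+ digit xa xb xc pow n i) base_fn step_fn.
have cauchy_y := yv_cauchy Hxa Hxb Hxc x_cauchy bounding Fn_pow pow0 powS Fn_Y Y0 YS.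
have apart := yv_apart Hxa Hxb Hxc x_cauchy Fn_pow pow0 powS Fn_Y YS.
have radius0 := radius_gt0 D HM Fn_pow pow0 powS.
have pow_pos := pow_gt0 D HM Fn_pow pow0 powS.
have Hp E cE f := @Fn_app1 M D HM E cE pow f Fn_pow.
have HY E cE f g := @Fn_app2 M D HM E cE Y f g Fn_Y.
have Hn := @Fn_npr M D HM.
(* Codes of rationals store the predecessor of the denominator, so [pow i] has to be written as a
   successor. *)
have den_ex i : exists c, c .+ '1 = pow i.
  have : '0 ≪ pow i by rewrite slt_lt emb0; exact: pow_pos.
  by move=> /(slt_ex D HM) [c ->]; exists c; vlra.
have den_dl : Dl (fun e : M * M => e.2 .+ '1 = pow e.1) by dec.
pose den i := mu (fun c => c .+ '1 = pow i).
have denE i : den i .+ '1 = pow i.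
  exact: (proj1 (muP D HM (P := fun i c => c .+ '1 = pow i) den_dl (den_ex i))).
have Fn_den : Fn den by exact: (Fn_mu D HM (P := fun i c => c .+ '1 = pow i) den_dl den_ex).
have Hden E cE f := @Fn_app1 M D HM E cE den f Fn_den.
have yvE i : yv D HM pow Y i = rat (Y i i) '0 (den i).
  by rewrite /yv /rat -denE embD emb0 emb1 subr0.
have [S HS] : exists S, forall p, smem p S <-> exists i, p = npr i (npr (npr (Y i i) '0) (den i)).
  by apply: graph_exists; dec.
have wholeE i a b c : whole S i a b c <-> [/\ a = Y i i, b = '0 & c = den i].
  rewrite /whole HS; split=> [[j /(npr_inj D HM) [-> /(npr_inj D HM) [/(npr_inj D HM) [-> ->] ->]]]|[-> -> ->]].
    by [].
  by exists i.
apply/sat_existsS; exists S; apply/sat_and; split; first (apply/sat_and; split).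
- apply/sat_and; split.
    apply/sat_forallN1 => p; apply/sat_imp => /HS [i Ep].
    apply/sat_existsN1; exists i; apply/sat_existsQ.
    by exists (Y i i), '0, (den i).
  apply/sat_forallN1 => i; apply/sat_existsN1.
  exists (npr (npr (Y i i) '0) (den i)); apply/sat_and; split; first by apply/HS; exists i.
  apply/sat_forallN1 => w; apply/sat_imp => /HS [j /(npr_inj D HM) [Ei Ew]].
  exact: etrans Ew (congr1 (fun i => npr (npr (Y i i) '0) (den i)) (esym Ei)).
- apply/(sat_cauchy (@entries_whole _ _ _)) => a b c abc.
  have [N HN] := cauchy_y a b c abc; exists N => m k [Hm Hk].
  move=> a1 b1 c1 a2 b2 c2 [/wholeE [-> -> ->] /wholeE [-> -> ->]].
  by rewrite -!yvE; split; exact: HN.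
- apply/sat_forallN1 => n; apply/sat_imp => /sat_and.
  move=> [/(sat_real_le (@entries_row _ _ _) (@entries_whole _ _ _)) le_xy].
  move=> /(sat_real_le (@entries_whole _ _ _) (@entries_row _ _ _)) le_yx.
  (* The implicit successor in the denominator makes this tolerance strictly smaller than
     [radius n], as the contradiction requires. *)
  pose c := ('1 .+ '1) .* pow (n .+ '1).
  have eps0 : 0 < rat '1 '0 c.
    by rewrite /rat emb1 emb0 subr0 divr_gt0 //; have := emb_ge0 D HM c; lra.
  have eps_lt : rat '1 '0 c < radius D HM pow n.
    rewrite /rat /radius emb1 emb0 subr0 div1r /c !(embM, embD, emb1).
    by rewrite ltf_pV2 ?posrE; have := pow_pos (n .+ '1); lra.
  have [N1 H1] := le_xy _ _ _ eps0; have [N2 H2] := le_yx _ _ _ eps0.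
  have [N3 H3] := apart n.
  pose i := N1 .+ N2 .+ N3.
  have i1 : ~ i ≪ N1 by rewrite /i; vlra.
  have i2 : ~ i ≪ N2 by rewrite /i; vlra.
  have i3 : ~ i ≪ N3 by rewrite /i; vlra.
  have Hx : row X n i (xa n i) (xb n i) (xc n i) by apply/rowE.
  have Hy : whole S i (Y i i) '0 (den i) by apply/wholeE.
  have := H1 i i1 _ _ _ _ _ _ (conj Hx Hy); have := H2 i i2 _ _ _ _ _ _ (conj Hy Hx).
  rewrite -yvE -/(xv D HM xa xb xc n i); exact: close_not_apart eps_lt (H3 i i3).
Qed.

End Translation.

Theorem proposition2p10 :
  proves (fun p => RCA0 p \/ p = IPP) reals_uncountable.
Proof.
apply: completeness => M HM rho sigma.
(* Definability inside the model presupposes that its sort of sets is inhabited; the given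
   assignment provides an element. *)
apply: (uncountable (sigma 0)).
  by move=> p Hp; apply: HM; left.
by move=> rho' sigma'; apply: HM; right.
Qed.
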